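(* (a) Let $k$ be a field of characteristic zero and let $A$ be an affine domain over $k$ (not necessarily commutative) of Gelfand-Kirillov dimension one. Then $A$ is cancellative. (b) Let $p$ be a prime. Then there exist a field $k$ of characteristic $p$ and an affine domain $A$ over $k$ (not necessarily commutative) of Gelfand-Kirillov dimension one such that $A$ is not cancellative.
   Context: Algebras are associative and unital, not necessarily commutative. An affine algebra over a field $k$ is a finitely generated $k$-algebra. A domain is a nonzero ring without zero divisors (not assumed commutative). For a $k$-algebra $A$, $A[t]$ denotes the polynomial ring in a central variable $t$. A $k$-algebra $A$ is called cancellative if, whenever $B$ is a $k$-algebra with $A[t]\cong B[t]$ as $k$-algebras, one has $A\cong B$ as $k$-algebras. *)

(* Defs.v *)
From HB Require Import structures.
From mathcomp Require Import all_boot all_order all_algebra.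
From mathcomp Require Import all_classical all_reals all_analysis.

Set Implicit Arguments.
Unset Strict Implicit.
Unset Printing Implicit Defensive.

Import Order.TTheory GRing.Theory Num.Theory.

Local Open Scope classical_set_scope.
Local Open Scope ring_scope.

(* A[t] as a k-algebra.  For noncommutative A, {poly A} is already the        *)
(* polynomial ring in a central variable, but the library only equips it with *)
(* a left A-module structure; the alias carries the k-algebra structure.      *)
Definition poly_alg (k : fieldType) (A : algType k) : Type := {poly A}.

HB.instance Definition _ (k : fieldType) (A : algType k) :=
  GRing.NzRing.on (poly_alg A).

Section PolyAlg.
Context (k : fieldType) (A : algType k).

Definition poly_alg_scale (a : k) (p : poly_alg A) : poly_alg A :=
  a%:A%:P * (p : {poly A}).

Lemma poly_alg_scaleA a b p :
  poly_alg_scale a (poly_alg_scale b p) = poly_alg_scale (a * b) p.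
Proof.
by rewrite /poly_alg_scale mulrA -polyCM -scalerAl mul1r scalerA.
Qed.

Lemma poly_alg_scale1 : left_id 1 poly_alg_scale.
Proof. by move=> p; rewrite /poly_alg_scale scale1r mul1r. Qed.

Lemma poly_alg_scaleDr : right_distributive poly_alg_scale +%R.
Proof. by move=> a p q; rewrite /poly_alg_scale mulrDr. Qed.

Lemma poly_alg_scaleDl p :
  {morph poly_alg_scale^~ p : a b / a + b >-> a + b}.
Proof. by move=> a b; rewrite /poly_alg_scale scalerDl polyCD mulrDl. Qed.

HB.instance Definition _ := GRing.Zmodule_isLmodule.Build k (poly_alg A)
  poly_alg_scaleA poly_alg_scale1 poly_alg_scaleDr poly_alg_scaleDl.

Lemma poly_alg_scaleAl (a : k) (p q : poly_alg A) : a *: (p * q) = (a *: p) * q.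
Proof. exact: mulrA. Qed.

HB.instance Definition _ :=
  GRing.LSemiModule_isLSemiAlgebra.Build k (poly_alg A) poly_alg_scaleAl.

Lemma poly_alg_scaleAr (a : k) (p q : poly_alg A) : a *: (p * q) = p * (a *: q).
Proof.
have comm (x : {poly A}) : x * a%:A%:P = a%:A%:P * x.
  apply/polyP => i; rewrite coefMC coefCM.
  by rewrite -scalerAr -scalerAl mulr1 mul1r.
have -> : a *: (p * q) = a%:A%:P * ((p : {poly A}) * q) by [].
have -> : p * (a *: q) = (p : {poly A}) * (a%:A%:P * q) by [].
by rewrite !mulrA comm.
Qed.

HB.instance Definition _ :=
  GRing.LSemiAlgebra_isSemiAlgebra.Build k (poly_alg A) poly_alg_scaleAr.

End PolyAlg.

Definition alg_iso (k : fieldType) (A B : algType k) : Prop :=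
  exists f : {lrmorphism A -> B}, bijective f.

(* In the library a k-algebra is nonzero.  Nothing is lost for B: the zero    *)
(* algebra cannot satisfy A[t] ~ B[t] when A is nonzero.                      *)
Definition cancellative (k : fieldType) (A : algType k) : Prop :=
  forall B : algType k, alg_iso (poly_alg A) (poly_alg B) -> alg_iso A B.

Definition affine (k : fieldType) (A : algType k) : Prop :=
  exists s : seq A,
    smallest (fun M : set A => GRing.subalg_closed [in M]) [set` s] = setT.

Definition is_domain (A : nzRingType) : Prop :=
  forall x y : A, x * y = 0 -> x = 0 \/ y = 0.

Section Dimension.
Context (k : fieldType) (V : lmodType k).

Definition lspan (X : set V) : set V :=
  smallest (fun M : set V => GRing.submod_closed [in M]) X.

Definition lin_indep (n : nat) (v : 'I_n -> V) : Prop :=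
  forall c : 'I_n -> k, \sum_(i < n) c i *: v i = 0 -> forall i, c i = 0.

Definition is_basis (W : set V) (n : nat) (v : 'I_n -> V) : Prop :=
  lin_indep v /\ lspan (range v) = W.

Definition fin_dim (W : set V) : Prop := exists s : seq V, lspan [set` s] = W.

(* only meaningful for finite-dimensional W; 0 otherwise *)
Definition ldim (W : set V) : nat :=
  xget 0%N [set n | exists v : 'I_n -> V, is_basis W v].

End Dimension.

Section GelfandKirillov.
Context (k : fieldType) (A : algType k).

Definition set_mul (V W : set A) : set A :=
  lspan [set z | exists x y, [/\ V x, W y & z = x * y]].

Fixpoint set_exp (V : set A) (n : nat) : set A :=
  if n is m.+1 then set_mul V (set_exp V m) else lspan [set 1].

(* V^0 + V^1 + ... + V^n *)
Definition filt (V : set A) (n : nat) : set A :=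
  lspan (\bigcup_(i < n.+1) set_exp V i).

(* sup over finite-dimensional V of limsup_n log_n (dim (V^0 + ... + V^n)) *)
Definition GKdim (R : realType) : \bar R :=
  ereal_sup [set limn_esup
      (fun n => (ln (ldim (filt V n))%:R / ln n%:R : R)%:E)
    | V in [set V : set A | fin_dim V]].

End GelfandKirillov.

(* Main.v *)
Require Import Defs.
From HB Require Import structures.
From mathcomp Require Import all_boot all_order all_algebra finfield.
From mathcomp Require Import all_classical all_reals all_analysis.
From mathcomp Require Import zify ring lra.
Set Implicit Arguments.
Unset Strict Implicit.
Unset Printing Implicit Defensive.
Import Order.TTheory GRing.Theory Num.Theory.
Local Open Scope ring_scope.

(** Part (a). Let phi : A[t] -> B[s] be an isomorphism, and view d/ds as a
    locally nilpotent derivation delta of A[t]. If delta kills A, then A is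
    carried into B; the kernel of delta is then exactly A, so phi identifies A
    with B. Otherwise the top homogeneous part of delta for the t-grading is
    still locally nilpotent; it kills t, because it maps t to a multiple of t
    and a locally nilpotent derivation d of a domain of characteristic zero
    never satisfies d f = g f <> 0. So it comes from a nonzero locally
    nilpotent derivation of A (leading_derivation, lnd_or_iso). As B is affine
    as well, the same dichotomy holds for B, and both algebras may be assumed
    to have such a derivation.

    Let dA be the derivation of A and D its kernel. If y in D were
    transcendental over k and x were a local slice, the monomials y^i x^j
    would be independent, and A would grow quadratically; so GKdim 1 makes D
    algebraic, hence a division ring (ker_division), and A is the Ore
    extension D[x; [x, -]] for a slice x. Elements of D^* are units of A[t],
    and units are constants of every locally nilpotent derivation, so phi
    carries D into the kernel D' of dB. Conversely an element b of D' outside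
    phi(D), a local slice y of dB and s would give about n^3 monomials b^i y^j
    s^l, left independent over D, of bounded degree in x and t; but there are
    only O(n^2) monomials x^i t^j of such degree (ker_preimage). Hence D' = D.
    Finally, look at the degree n in x of y at t = 0. If n = 1, evaluation at
    t = 0 is an isomorphism B -> A. If n > 1, the coefficient of x^(n-1) in
    [y, a], a in D, shows that some slice of A commutes with D; if n = 0, some
    slice of B commutes with D'. Either case implies the other, and then A and
    B are both polynomial rings over D (match_trichotomy,
    central_slice_transfer, central_slices_iso).

    Part (b). In characteristic p an Ore variable x with [x, c] = delta(c)
    satisfies [x^p, c] = delta^p(c). If delta and delta' are derivations of a
    field K with delta^p = delta' and delta'^p = delta, then x |-> y^p - s and
    t |-> y - (y^p - s)^p define an isomorphism K[x; delta][t] -> K[y;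
    delta'][s] (poly_ore_iso). On the other hand, if K is purely inseparable
    over k, an isomorphism K[x; delta] -> K[y; delta'] is the identity on K
    and maps x to c_0 + c_1 y, so that delta = c_1 delta' (ore_not_iso). For K
    = E(u, v) over k = K^p with E = F_(p^2), take delta u = u, delta v = l v
    and delta' u = u, delta' v = l^p v where l^p <> l: the weights lie in
    F_(p^2), whence delta^(p^2) = delta, and delta, delta' are not
    proportional. Since K is finite over k, K[x; delta] is affine of Gelfand-
    Kirillov dimension one. *)

(** * Iterates of a derivation *)

Definition leibniz (R : nzRingType) (d : R -> R) : Prop :=
  forall f g, d (f * g) = d f * g + f * d g.

Definition loc_nilp (R : nzRingType) (d : R -> R) : Prop :=
  forall a, exists n, iter n d a = 0.

Section Iterates.
Context (R : nzRingType).

Lemma iter_raddf0 (d : {additive R -> R}) n : iter n d 0 = 0.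
Proof. by elim: n => //= n ->; rewrite raddf0. Qed.

Lemma iter_raddfD (d : {additive R -> R}) n : {morph iter n d : x y / x + y}.
Proof. by move=> x y; elim: n => //= n ->; rewrite raddfD. Qed.

Lemma iter_raddf_sum (d : {additive R -> R}) n I (r : seq I) (P : pred I) F :
  iter n d (\sum_(i <- r | P i) F i) = \sum_(i <- r | P i) iter n d (F i).
Proof.
by elim/big_rec2: _ => [|i x y _ <-]; rewrite ?iter_raddf0 ?iter_raddfD.
Qed.

Lemma iter_eq0_leq (d : {additive R -> R}) m n a :
  (m <= n)%N -> iter m d a = 0 -> iter n d a = 0.
Proof. by move=> /subnK <- h; rewrite iterD h iter_raddf0. Qed.

(** Two operators T and d are needed: with T the left multiplication by x and
    d = [x, -] the formula expands x^n f, and with T = d it is the usual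
    Leibniz formula. *)
Lemma iter_leibniz (d T : {additive R -> R}) n f g :
    (forall f g, T (f * g) = d f * g + f * T g) ->
  iter n T (f * g) =
    \sum_(i < n.+1) (iter i d f * iter (n - i) T g) *+ 'C(n, i).
Proof.
move=> dT; elim: n => [|n IH]; first by rewrite big_ord1 bin0.
rewrite iterS IH raddf_sum /=.
under eq_bigr => i _ do rewrite raddfMn dT mulrnDl.
rewrite big_split /= [RHS]big_ord_recl /= bin0 mulr1n ?subn0.
under [in RHS]eq_bigr => i _ do rewrite /bump /= add1n subSS binS mulrnDr.
rewrite big_split /= [LHS]addrC [RHS]addrA; congr (_ + _).
rewrite big_ord_recl /= bin0 mulr1n subn0; congr (_ + _).
rewrite [RHS]big_ord_recr /= bin_small // mulr0n addr0.
apply: eq_bigr => i _; rewrite /bump /= add1n.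
by rewrite -[in RHS](@subnSK i n) // iterS.
Qed.

Section Order.
Context (d : {additive R -> R}) (dL : leibniz d).

Lemma iter_mul n f g :
  iter n d (f * g) = \sum_(i < n.+1) (iter i d f * iter (n - i) d g) *+ 'C(n, i).
Proof. exact: iter_leibniz. Qed.

(** For a locally nilpotent d, this makes the order of vanishing of the
    iterates behave like a degree: only one term of the Leibniz formula
    survives. *)
Lemma iter_mul_top n m f g :
    iter n.+1 d f = 0 -> iter m.+1 d g = 0 ->
  iter (n + m) d (f * g) = (iter n d f * iter m d g) *+ 'C(n + m, n).
Proof.
move=> hf hg; rewrite iter_mul.
have ln : (n < (n + m).+1)%N by rewrite ltnS leq_addr.
rewrite (bigD1 (Ordinal ln)) //= addKn big1 ?addr0 // => i.
rewrite -val_eqE /= neq_ltn => /orP[lt|lt].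
  by rewrite [X in _ * X](@iter_eq0_leq _ m.+1) ?mulr0 ?mul0rn //; lia.
by rewrite [X in X * _](@iter_eq0_leq _ n.+1) ?mul0r ?mul0rn.
Qed.

Lemma iter_mul_eq0 n m f g :
    iter n.+1 d f = 0 -> iter m.+1 d g = 0 -> iter (n + m).+1 d (f * g) = 0.
Proof.
move=> hf hg; rewrite iter_mul big1 // => i _.
have [le|lt] := leqP i n.
  by rewrite [X in _ * X](@iter_eq0_leq _ m.+1) ?mulr0 ?mul0rn //; lia.
by rewrite [X in X * _](@iter_eq0_leq _ n.+1) ?mul0r ?mul0rn.
Qed.

Lemma leibniz1 : d 1 = 0.
Proof.
have := dL 1 1; rewrite !mulr1 mul1r => /eqP; rewrite -subr_eq subrr => /eqP.
by move=> <-.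
Qed.

Lemma der_kerM a b : d a = 0 -> d b = 0 -> d (a * b) = 0.
Proof. by move=> ha hb; rewrite dL ha hb mul0r mulr0 addr0. Qed.

Lemma der_kerX a n : d a = 0 -> d (a ^+ n) = 0.
Proof.
by move=> ha; elim: n => [|n IH]; rewrite ?expr0 ?leibniz1 // exprS der_kerM.
Qed.

Lemma iter_kerM n a b : d a = 0 -> iter n d (a * b) = a * iter n d b.
Proof. by move=> ha; elim: n => //= n ->; rewrite dL ha mul0r add0r. Qed.

End Order.
End Iterates.

(** * Locally nilpotent derivations of a domain of characteristic zero *)

Definition torsion_free (R : nzRingType) : Prop :=
  forall (a : R) n, a *+ n.+1 = 0 -> a = 0.

Lemma pchar0_torsion_free (k : fieldType) (A : algType k) :
  [pchar k] =i pred0 -> torsion_free A.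
Proof.
move=> /pcharf0P h a n /eqP.
by rewrite -scaler_nat scaler_eq0 h /= => /eqP.
Qed.

Section LocallyNilpotent.
Context (R : nzRingType) (dom : is_domain R) (tf : torsion_free R).
Context (d : {additive R -> R}) (dL : leibniz d) (dN : loc_nilp d).

Lemma domain_mulf_neq0 (x y : R) : x <> 0 -> y <> 0 -> x * y <> 0.
Proof. by move=> hx hy /dom[]. Qed.

Lemma torsion_free_mulrn (x : R) n : x <> 0 -> (0 < n)%N -> x *+ n <> 0.
Proof. by case: n => // n hx _ /tf. Qed.

Lemma lnd_order a : a <> 0 -> exists2 n, iter n d a <> 0 & iter n.+1 d a = 0.
Proof.
move=> a0; have [n] := dN a; elim: n => [//|n IH] hn.
by have [/IH//|h] := pselect (iter n d a = 0); exists n.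
Qed.

Lemma iter_mul_neq0 n m f g :
    iter n.+1 d f = 0 -> iter m.+1 d g = 0 ->
  iter n d f <> 0 -> iter m d g <> 0 -> iter (n + m) d (f * g) <> 0.
Proof.
move=> hf hg nf ng; rewrite iter_mul_top //.
by apply: torsion_free_mulrn; [apply: domain_mulf_neq0|rewrite bin_gt0 leq_addr].
Qed.

(** Otherwise d f = g f would have the order of f minus one as well as the
    order of f plus the order of g. *)
Lemma lnd_no_eigen f g : d f = g * f -> d f = 0.
Proof.
have [->|f0] := pselect (f = 0); first by rewrite raddf0.
have [->|g0] := pselect (g = 0); first by rewrite mul0r.
have [n fn fn1] := lnd_order f0; have [m gm gm1] := lnd_order g0.
move=> df; have [] := iter_mul_neq0 gm1 fn1 gm fn.
by rewrite -df -iterSr (@iter_eq0_leq _ _ n.+1) // ltnS leq_addl.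
Qed.

(** Orders are nonnegative and add up to the order of 1, which is zero. *)
Lemma lnd_unit u v : u * v = 1 -> d u = 0.
Proof.
move=> uv.
have u0 : u <> 0 by move=> u0; have /eqP := uv; rewrite u0 mul0r eq_sym oner_eq0.
have v0 : v <> 0 by move=> v0; have /eqP := uv; rewrite v0 mulr0 eq_sym oner_eq0.
have [[|n] un un1] := lnd_order u0; first by [].
have [m vm vm1] := lnd_order v0.
have [] := iter_mul_neq0 un1 vm1 un vm.
by rewrite uv addSn (@iter_eq0_leq _ _ 1) //= leibniz1.
Qed.

Lemma order_exp n z i : iter n.+1 d z = 0 -> iter n d z <> 0 ->
  iter (n * i).+1 d (z ^+ i) = 0 /\ iter (n * i) d (z ^+ i) <> 0.
Proof.
move=> h1 h0; elim: i => [|i [IH1 IH0]].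
  by rewrite muln0 expr0 /= leibniz1 //; split => //; apply/eqP/oner_neq0.
by rewrite exprS mulnS; split; [apply: iter_mul_eq0|apply: iter_mul_neq0].
Qed.

(** If z has order n > 0, then z^i has order exactly n i, so applying d the
    order of the top monomial many times isolates the leading coefficient. *)
Lemma ker_transcendental (z : R) (p : {poly R}) :
  d z <> 0 -> (forall i, d p`_i = 0) -> p.[z] = 0 -> p = 0.
Proof.
move=> dz kp pz; apply/eqP/negPn/negP => p0.
have z0 : z <> 0 by move=> z0; apply: dz; rewrite z0 raddf0.
have [[|n] zn zn1] := lnd_order z0; first by [].
set N := (size p).-1.
(* The order of z is n.+1, so n.+1 * N is the order of the top monomial. *)
have := congr1 (iter (n.+1 * N) d) pz.
rewrite horner_coef iter_raddf0 iter_raddf_sum -(ltn_predK (m := 0) (n := size p)) ?size_poly_gt0 //.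
rewrite big_ord_recr big1 /= => [|i _]; last first.
  rewrite iter_kerM // (@iter_eq0_leq _ _ (n.+1 * i).+1) ?mulr0 //.
    by rewrite ltn_pmul2l.
  by case: (order_exp i zn1 zn).
rewrite add0r iter_kerM // => /dom[/eqP|].
  by rewrite -/(lead_coef p) lead_coef_eq0 (negPf p0).
by case: (order_exp N zn1 zn).
Qed.

Lemma horner_inj z (p q : {poly R}) :
    d z <> 0 -> (forall i, d p`_i = 0) -> (forall i, d q`_i = 0) ->
  p.[z] = q.[z] -> p = q.
Proof.
move=> dz kp kq pq; apply/eqP; rewrite -subr_eq0; apply/eqP.
apply: (@ker_transcendental z) => //; last by rewrite hornerD hornerN pq subrr.
by move=> i; rewrite coefB raddfB kp kq subrr.
Qed.

(** Take the last nonzero iterate but one. *)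
Lemma local_slice : (exists a, d a <> 0) -> exists2 z, d z <> 0 & d (d z) = 0.
Proof.
case=> a da; have a0 : a <> 0 by move=> a0; apply: da; rewrite a0 raddf0.
have [[//|n] h0 h1] := lnd_order a0.
by exists (iter n d a).
Qed.

End LocallyNilpotent.

Lemma iter_exp_fact (R : nzRingType) (d : {additive R -> R}) z n : leibniz d ->
  d (d z) = 0 -> iter n d (z ^+ n) = (d z) ^+ n *+ n`! /\ iter n.+1 d (z ^+ n) = 0.
Proof.
move=> dL ddz; elim: n => [|n [IH IH1]].
  by rewrite !expr0 fact0 /= leibniz1.
rewrite !exprS; split; last by apply: (@iter_mul_eq0 _ _ dL 1 n).
rewrite -add1n (iter_mul_top dL) //= IH bin1 mulrnAr -mulrnA.
by rewrite factS mulnC.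
Qed.

(** Taylor expansion: if d^n a is the last nonzero iterate, it is also the
    last nonzero iterate of a suitable multiple of z^n, and subtracting that
    multiple lowers the order. The element e is the inverse of d z. *)
Lemma slice_decomposition (k : fieldType) (A : algType k) (d : {linear A -> A})
    (z e : A) :
    [pchar k] =i pred0 -> leibniz d ->
    d (d z) = 0 -> d e = 0 -> e * d z = 1 ->
  forall n a, iter n d a = 0 ->
  exists p : {poly A}, [/\ (size p <= n)%N, forall i, d p`_i = 0 & p.[z] = a].
Proof.
move=> /pcharf0P ch dL ddz de edz.
elim=> [|n IH] a /=.
  move=> ->; exists 0; split=> [|i|]; rewrite ?size_poly0 ?horner0 //.
  by rewrite coef0 raddf0.
move=> han.
(* The n-th iterate of z^n is n! (d z)^n. *)
set c := (n`!%:R^-1 : k) *: (iter n d a * e ^+ n).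
have dc : d c = 0.
  by rewrite linearZ /= der_kerM ?scaler0 // der_kerX.
have [|p [sp kp pa]] := IH (a - c * z ^+ n).
  have -> : a - c * z ^+ n = a + (- c) * z ^+ n by rewrite mulNr.
  rewrite iter_raddfD iter_kerM //; last by rewrite raddfN /= dc oppr0.
  rewrite (iter_exp_fact n dL ddz).1 mulNr /c -scalerAl mulrnAr -mulrA.
  have -> : e ^+ n * d z ^+ n = 1.
    elim: (n) => [|m IHm]; first by rewrite !expr0 mulr1.
    by rewrite exprSr exprS mulrA -(mulrA _ e) edz mulr1.
  rewrite mulr1 -scaler_nat scalerA mulVf ?scale1r ?subrr //.
  by rewrite ch -lt0n fact_gt0.
exists (p + c *: 'X^n); split; last first.
- by rewrite hornerD pa hornerZ hornerXn subrK.
- move=> i; rewrite coefD coefZ coefXn raddfD /= kp add0r.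
  by case: (_ == _); rewrite ?mulr1 ?mulr0 ?dc ?raddf0.
apply: leq_trans (size_polyD _ _) _; rewrite geq_max leqW //=.
by apply: leq_trans (size_scale_leq _ _) _; rewrite size_polyXn.
Qed.

Lemma slice_expansion (k : fieldType) (A : algType k) (d : {linear A -> A}) (z : A) :
    [pchar k] =i pred0 -> leibniz d -> d z = 1 ->
  forall n a, iter n d a = 0 ->
  exists p : {poly A}, [/\ (size p <= n)%N, forall i, d p`_i = 0 & p.[z] = a].
Proof.
move=> ch dL dz; apply: (slice_decomposition (e := 1)) => //.
- by rewrite dz leibniz1.
- exact: leibniz1.
- by rewrite dz mulr1.
Qed.

(** The form of the independence of powers used to compare sums over ordinals. *)
Lemma ker_free (R : nzRingType) (dom : is_domain R) (tf : torsion_free R)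
    (d : {additive R -> R}) (dL : leibniz d) (dN : loc_nilp d) z n (c : 'I_n -> R) :
    d z <> 0 -> (forall i, d (c i) = 0) -> \sum_i c i * z ^+ i = 0 ->
  forall i, c i = 0.
Proof.
move=> dz dc c0 i.
pose p : {poly R} := \poly_(j < n) oapp c 0 (insub j).
have pE (j : 'I_n) : p`_j = c j by rewrite coef_poly ltn_ord valK.
suff p0 : p = 0 by rewrite -pE p0 coef0.
apply: (ker_transcendental dom tf dL dN dz).
  move=> j; rewrite coef_poly; case: ltnP => [lt|_]; last exact: raddf0.
  by rewrite insubT /= dc.
by rewrite horner_poly -[RHS]c0; apply: eq_bigr => j _; rewrite valK.
Qed.

(** * Leading forms of derivations of a polynomial ring *)

Lemma poly_domain (R : nzRingType) : is_domain R -> is_domain {poly R}.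
Proof.
move=> dom p q pq; have [->|p0] := eqVneq p 0; first by left.
have [->|q0] := eqVneq q 0; first by right.
have lpq : lead_coef p * lead_coef q <> 0.
  by move=> /dom[] /eqP; rewrite lead_coef_eq0 (negPf p0, negPf q0).
have := lead_coef_proper_mul (introN eqP lpq).
by rewrite pq lead_coef0 => /esym.
Qed.

Lemma poly_torsion_free (R : nzRingType) : torsion_free R -> torsion_free {poly R}.
Proof.
move=> tf p n /polyP pn; apply/polyP => i; rewrite coef0.
by apply: (tf _ n); rewrite -coefMn pn coef0.
Qed.

(** The bounds may fail to be attained; both sides are then zero. *)
Lemma coefM_top (R : nzRingType) (p q : {poly R}) m n :
    (size p <= m.+1)%N -> (size q <= n.+1)%N ->
  (p * q)`_(m + n) = p`_m * q`_n.
Proof.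
move=> hp hq; rewrite coefM.
have lm : (m < (m + n).+1)%N by rewrite ltnS leq_addr.
rewrite (bigD1 (Ordinal lm)) //= addKn big1 ?addr0 // => i.
rewrite -val_eqE /= neq_ltn => /orP[lt|lt].
  by rewrite (nth_default _ (s := q)) ?mulr0 //; lia.
by rewrite (nth_default _ (s := p)) ?mul0r //; lia.
Qed.

Lemma size_leqS (R : nzRingType) (p : {poly R}) n :
  (size p <= n.+1)%N -> p`_n = 0 -> (size p <= n)%N.
Proof.
move=> /leq_sizeP hs h0; apply/leq_sizeP => j.
by rewrite leq_eqVlt => /orP[/eqP <-//|/hs].
Qed.

Lemma loc_nilpD (R : nzRingType) (d : {additive R -> R}) a b :
    (exists n, iter n d a = 0) -> (exists n, iter n d b = 0) ->
  exists n, iter n d (a + b) = 0.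
Proof.
move=> [m hm] [n hn]; exists (m + n)%N; rewrite iter_raddfD.
by rewrite (iter_eq0_leq (leq_addr n m) hm) (iter_eq0_leq (leq_addl m n) hn) addr0.
Qed.

Lemma map_poly_leibniz (R : nzRingType) (d : {additive R -> R}) :
  leibniz d -> leibniz (map_poly d).
Proof.
move=> dL f g; apply/polyP => i.
rewrite coef_map coefM raddf_sum coefD !coefM -big_split.
by apply: eq_bigr => j _; rewrite dL !coef_map.
Qed.

Lemma leibniz_combine (R : nzRingType) (d1 d2 : R -> R) (u v : R) :
    leibniz d1 -> leibniz d2 -> (forall x, u * x = x * u) ->
  (forall x, v * x = x * v) -> leibniz (fun f => d1 f * u + d2 f * v).
Proof.
move=> h1 h2 hu hv f g; rewrite h1 h2 !mulrDl !mulrDr -!(mulrA _ _ g).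
by rewrite (hu g) (hv g) !mulrA addrACA.
Qed.

(** A derivation maps central elements to central elements. *)
Lemma leibniz_poly_comm (R : nzRingType) (delta : {additive {poly R} -> {poly R}}) p :
  leibniz delta -> delta 'X * p = p * delta 'X.
Proof.
move=> dL.
have := congr1 delta (commr_polyX p); rewrite !dL -(commr_polyX (delta p)).
by rewrite addrC => /addIr ->.
Qed.

(** Both sides are derivations in p that kill the coefficients and agree at
    the variable. *)
Lemma leibniz_poly_deriv (R : nzRingType) (delta : {additive {poly R} -> {poly R}}) p :
  leibniz delta -> (forall a, delta a%:P = 0) -> delta p = p^`() * delta 'X.
Proof.
move=> dL hc; elim/poly_ind: p => [|p a IH].
  by rewrite raddf0 deriv0 mul0r.
rewrite raddfD /= hc addr0 dL IH -mulrA leibniz_poly_comm // mulrA -mulrDl.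
by rewrite derivD derivC derivM derivX mulr1 addr0.
Qed.

(** Give t weight one and the coefficients weight zero. If delta raises
    weights by at most D, its part of weight D exactly, homog below, is again
    a locally nilpotent derivation. It is determined by lead_der on the
    coefficients and by the central coefficient c of delta t. *)
Section LeadingForm.
Context (R : nzRingType) (dom : is_domain R) (tf : torsion_free R).
Context (delta : {additive {poly R} -> {poly R}}).
Context (dL : leibniz delta) (dN : loc_nilp delta).

Let weight_le D :=
  (forall a, size (delta a%:P) <= D.+1)%N /\ (size (delta 'X) <= D.+2)%N.

Let dX_comm p : delta 'X * p = p * delta 'X.
Proof. exact: leibniz_poly_comm. Qed.

Section Weight.
Context (D : nat) (hD : weight_le D).

Let lead_der : {additive R -> R} := coefp D \o delta \o polyC.
Let c := (delta 'X)`_D.+1.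

Let cC (a : R) : c * a = a * c.
Proof. by rewrite /c -coefMC -coefCM dX_comm. Qed.

Lemma lead_der_leibniz : leibniz lead_der.
Proof.
move=> a b; rewrite /= polyCM dL coefD coefMC coefCM.
by [].
Qed.

(** The top coefficient of delta p depends on the top coefficient of p only:
    this is where delta and homog agree. *)
Lemma delta_top m (p : {poly R}) : (size p <= m.+1)%N ->
  (size (delta p) <= (m + D).+1)%N /\
  (delta p)`_(m + D) = lead_der p`_m + (c * p`_m) *+ m.
Proof.
elim: m p => [|m IH] p hp.
  by rewrite (size1_polyC hp) add0n mulr0n addr0 coefC /=; split => //; case: hD.
have [q [a]] : exists q, exists a, p = q * 'X + a%:P.
  by elim/poly_ind: (p) => [|q a _]; [exists 0, 0; rewrite mul0r addr0 ?polyC0|exists q, a].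
move=> pE; have hq : (size q <= m.+1)%N.
  have [q0|q0] := eqVneq q 0; first by rewrite q0 size_poly0.
  by move: hp; rewrite pE size_MXaddC (negPf q0) /= ltnS.
have [IH1 IH2] := IH _ hq; have [ha hX] := hD.
have -> : p`_m.+1 = q`_m by rewrite pE coefD coefMX coefC /= addr0.
rewrite pE raddfD /= dL -dX_comm; split.
  apply: (leq_trans (size_polyD _ _)); rewrite geq_max; apply/andP; split; last first.
    by apply: leq_trans (ha a) _; lia.
  apply: (leq_trans (size_polyD _ _)); rewrite geq_max; apply/andP; split.
    apply: leq_trans (size_polyMleq _ _) _; rewrite size_polyX; lia.
  apply: leq_trans (size_polyMleq _ _) _; lia.
rewrite !coefD coefMX addSn /= IH2 -addnS addnC coefM_top // -/c.
rewrite [(delta a%:P)`__]nth_default ?addr0; last by apply: leq_trans (ha a) _; lia.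
by rewrite -addrA -mulrSr.
Qed.

Let homogf (f : {poly R}) := map_poly lead_der f * 'X^D + f^`() * (c%:P * 'X^(D.+1)).

Let homogf_additive : zmod_morphism homogf.
Proof.
move=> f g; rewrite /homogf raddfB derivB !mulrBl opprD.
by rewrite !addrA; congr (_ + _); rewrite -!addrA; congr (_ + _); rewrite addrC.
Qed.

Let homog : {additive {poly R} -> {poly R}} :=
  HB.pack homogf (GRing.isZmodMorphism.Build _ _ _ homogf_additive).

Let XnC (p : {poly R}) n : 'X^n * p = p * 'X^n.
Proof. by rewrite commr_polyXn. Qed.

Let homog_leibniz : leibniz homog.
Proof.
apply: leibniz_combine; first exact/map_poly_leibniz/lead_der_leibniz.
- exact: derivM.
- by move=> p; rewrite commr_polyXn.
move=> p; rewrite -mulrA -(commr_polyXn p) !mulrA; congr (_ * _).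
by apply/polyP => i; rewrite coefMC coefCM cC.
Qed.

Let homog_monomial m a : homog (a%:P * 'X^m) = (lead_der a + (c * a) *+ m)%:P * 'X^(m + D).
Proof.
rewrite /= /homogf polyCD mulrDl; congr (_ + _).
  rewrite exprD mulrA; congr (_ * _); apply/polyP => i.
  rewrite coef_map !coefCM coefXn; case: (_ == _); rewrite ?mulr1 ?mulr0 //.
  exact: raddf0.
rewrite derivM derivC mul0r add0r derivXn.
case: m => [|m]; first by rewrite !mulr0n mulr0 !mul0r.
rewrite /= mulrnAr mulrnAl mulrA -(mulrA a%:P) XnC -!mulrA -exprD mulrA -polyCM -cC.
by rewrite polyCMn mulrnAl addnS addSn.
Qed.

Hypothesis nz : (exists a, lead_der a <> 0) \/ c <> 0.

(** Local nilpotence of homog is read off from the top coefficients of the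
    iterates of delta. *)
Let iter_delta_top m a n : exists b,
  [/\ iter n homog (a%:P * 'X^m) = b%:P * 'X^(m + n * D),
      (size (iter n delta (a%:P * 'X^m)%R) <= (m + n * D).+1)%N
    & (iter n delta (a%:P * 'X^m))`_(m + n * D) = b].
Proof.
elim: n => [|n [b [IH1 IH2 IH3]]].
  exists a; rewrite mul0n addn0; split => //=; last first.
    by rewrite coefCM coefXn eqxx mulr1.
  by apply: leq_trans (size_polyMleq _ _) _; rewrite size_polyXn size_polyC; lia.
have [h1 h2] := delta_top IH2.
exists (lead_der b + (c * b) *+ (m + n * D)).
have -> : (m + n.+1 * D = m + n * D + D)%N by rewrite mulSn; lia.
split => //.
  by rewrite iterS IH1 homog_monomial.
by rewrite iterS h2 IH3.
Qed.

Let homog_loc_nilp : loc_nilp homog.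
Proof.
have mono a m : exists n, iter n homog (a%:P * 'X^m) = 0.
  have [n hn] := dN (a%:P * 'X^m); exists n.
  by have [b [-> _]] := iter_delta_top m a n; rewrite hn coef0 => <-; rewrite mul0r.
move=> p; rewrite -(coefK p) poly_def.
elim/big_ind: _ => [|x y hx hy|i _]; first by exists 0%N.
  exact: loc_nilpD.
by rewrite -mul_polyC.
Qed.

(** The variable would be an eigenvector of homog: its image is (c t^D) t. *)
Let c_eq0 : c = 0.
Proof.
have GX : homog 'X = ((c * 1)%:P * 'X^D) * 'X.
  have := homog_monomial 1 1; rewrite mul1r expr1 => ->.
  rewrite leibniz1 ?add0r; last exact: lead_der_leibniz.
  by rewrite mulr1n add1n exprSr mulrA.
have := lnd_no_eigen (poly_domain dom) (poly_torsion_free tf) homog_leibniz homog_loc_nilp GX.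
rewrite GX mulr1 => /polyP/(_ D.+1).
by rewrite coefMX /= coefCM coefXn eqxx mulr1 coef0.
Qed.

Let lead_der_loc_nilp : loc_nilp lead_der.
Proof.
move=> a; have [n] := homog_loc_nilp a%:P; exists n.
have E j : iter j homog a%:P = (iter j lead_der a)%:P * 'X^(j * D).
  elim: j => [|j IH]; first by rewrite mul0n expr0 mulr1.
  by rewrite iterS IH homog_monomial c_eq0 mul0r mul0rn addr0 mulSn addnC.
move: p; rewrite E => /polyP/(_ (n * D)%N).
by rewrite coefCM coefXn eqxx mulr1 coef0.
Qed.

Lemma leading_lnd : [/\ leibniz lead_der, loc_nilp lead_der & exists a, lead_der a <> 0].
Proof.
split; [exact: lead_der_leibniz|exact: lead_der_loc_nilp|].
by case: nz => // /(_ c_eq0).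
Qed.

End Weight.

(** Choosing D minimal makes the homogeneous part nonzero. For D = 0
    minimality says nothing, and a nonzero value of delta on some constant is
    used instead. *)
Lemma leading_derivation :
    (exists N, forall a, (size (delta a%:P) <= N)%N) -> (exists a, delta a%:P <> 0) ->
  exists D, let d0 : {additive R -> R} := coefp D \o delta \o polyC in
    [/\ leibniz d0, loc_nilp d0 & exists a, d0 a <> 0].
Proof.
move=> [N hN] [a0 ha0].
have exW : exists D, `[< weight_le D >].
  exists (maxn N (size (delta 'X))); apply/asboolP; split=> [a|].
    by apply: leq_trans (hN a) _; lia.
  by lia.
case: (ex_minnP exW) => D /asboolP hD minD; exists D.
apply: (leading_lnd hD); apply: contrapT => /not_orP[/forallNP nd /contrapT nc].
have {}nd a : (size (delta a%:P) <= D)%N.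
  by apply: size_leqS; [case: hD|have /contrapT := nd a].
case: D hD minD nc nd => [|D] hD minD nc nd.
  by apply: ha0; apply/eqP; rewrite -size_poly_leq0; exact: nd.
suff /asboolP/minD : weight_le D by rewrite ltnn.
by split=> //; apply: size_leqS => //; case: hD.
Qed.
End LeadingForm.

(** * Isomorphisms between polynomial algebras *)

Section AlgebraMaps.
Context (k : fieldType).

(** Isomorphisms are given with an explicit inverse morphism from here on. *)
Lemma lrmorphism_inverse (A B : algType k) (f : {lrmorphism A -> B}) :
  bijective f -> exists g : {lrmorphism B -> A}, cancel f g /\ cancel g f.
Proof.
case=> g fK gK.
have lg : linear g.
  by move=> c x y; apply: (can_inj fK); rewrite linearP /= !gK.
have mg : monoid_morphism g.
  by split=> [|x y]; apply: (can_inj fK); rewrite ?rmorphM ?rmorph1 /= !gK.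
pose g' : {lrmorphism B -> A} := HB.pack g
  (GRing.isLinear.Build _ _ _ _ g lg) (GRing.isMonoidMorphism.Build _ _ g mg).
by exists g'.
Qed.

Lemma alg_iso_sym (A B : algType k) : alg_iso A B -> alg_iso B A.
Proof.
by case=> f /lrmorphism_inverse[g [fK gK]]; exists g; exists f.
Qed.

(** The inclusion of the coefficients, named so as to carry its algebra
    morphism structure into the algebra poly_alg A. *)
Definition constp (A : algType k) : A -> poly_alg A := polyC.

Fact constp_linear (A : algType k) : linear (@constp A).
Proof.
move=> c x y; rewrite /constp polyCD; congr (_ + _).
by rewrite -[in LHS](mul1r x) scalerAl polyCM.
Qed.

Fact constp_monoid_morphism (A : algType k) : monoid_morphism (@constp A).
Proof. by split=> [|x y] //; rewrite /constp polyCM. Qed.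

HB.instance Definition _ (A : algType k) :=
  GRing.isLinear.Build _ _ _ _ (@constp A) (@constp_linear A).
HB.instance Definition _ (A : algType k) :=
  GRing.isMonoidMorphism.Build _ _ (@constp A) (@constp_monoid_morphism A).

Lemma coef_scale (A : algType k) (c : k) (p : poly_alg A) i :
  ((c *: p : poly_alg A) : {poly A})`_i = c *: (p : {poly A})`_i.
Proof.
by rewrite -[LHS]/((c%:A%:P * (p : {poly A}))`_i) coefCM -scalerAl mul1r.
Qed.

(** Evaluation at zero, the retraction of constp. *)
Definition eval0 (A : algType k) (p : poly_alg A) : A := (p : {poly A})`_0.

Fact eval0_linear (A : algType k) : linear (@eval0 A).
Proof. by move=> c x y; rewrite /eval0 coefD coef_scale. Qed.

Fact eval0_monoid_morphism (A : algType k) : monoid_morphism (@eval0 A).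
Proof.
split=> [|x y]; rewrite /eval0; first by rewrite coef1.
by rewrite coefM big_ord1.
Qed.

HB.instance Definition _ (A : algType k) :=
  GRing.isLinear.Build _ _ _ _ (@eval0 A) (@eval0_linear A).
HB.instance Definition _ (A : algType k) :=
  GRing.isMonoidMorphism.Build _ _ (@eval0 A) (@eval0_monoid_morphism A).

Lemma constpK (A : algType k) : cancel (@constp A) (@eval0 A).
Proof. by move=> a; rewrite /eval0 /constp coefC. Qed.

Definition derivp (A : algType k) (p : poly_alg A) : poly_alg A :=
  deriv (p : {poly A}).

Fact derivp_linear (A : algType k) : linear (@derivp A).
Proof.
move=> c x y; rewrite /derivp derivD; congr (_ + _).
by rewrite -[c *: x]/(c%:A%:P * (x : {poly A})) derivM derivC mul0r add0r.
Qed.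

HB.instance Definition _ (A : algType k) :=
  GRing.isLinear.Build _ _ _ _ (@derivp A) (@derivp_linear A).

Lemma derivp_leibniz (A : algType k) : leibniz (@derivp A).
Proof. by move=> f g; rewrite /derivp derivM. Qed.

Lemma derivp_loc_nilp (A : algType k) : loc_nilp (@derivp A).
Proof.
by move=> p; exists (size (p : {poly A})); apply: (@derivn_poly0 _ p).
Qed.

Lemma derivp_eq0 (A : algType k) (p : poly_alg A) : torsion_free A ->
  derivp p = 0 -> p = constp (eval0 p).
Proof.
move=> tf /polyP p0; apply/polyP => -[|i]; rewrite coefC //=.
by apply: (tf _ i); have := p0 i; rewrite coef_deriv coef0.
Qed.

End AlgebraMaps.

(** Induction form of finite generation, in terms of plain predicates. *)
Lemma affineP (k : fieldType) (A : algType k) : affine A <->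
  exists s : seq A, forall P : A -> Prop,
    P 1 -> (forall c x y, P x -> P y -> P (c *: x + y)) ->
    (forall x y, P x -> P y -> P (x * y)) -> (forall x, x \in s -> P x) ->
    forall a, P a.
Proof.
split=> -[s hs]; exists s.
  move=> P P1 Pl PM Ps a.
  have : [set: A]%classic a by [].
  rewrite -hs => /(_ [set x | P x]%classic); apply; split => //.
  split=> [|c x y|x y]; rewrite !inE //=; [exact: Pl|exact: PM].
rewrite eqEsubset; split=> // a _ M [[M1 Ml MM] sM].
apply: hs => [|c x y|x y|x /sM //]; first by move: M1; rewrite inE.
  by move=> hx hy; have := Ml c x y; rewrite !inE => /(_ hx hy).
by move=> hx hy; have := MM x y; rewrite !inE => /(_ hx hy).
Qed.

(** The derivation delta is d/ds on B[s], seen on A[t] through phi. *)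
Section LndOrIso.
Context (k : fieldType) (A B : algType k) (ch : [pchar k] =i pred0).
Context (domA : is_domain A).
Context (phi : {lrmorphism poly_alg A -> poly_alg B}).
Context (psi : {lrmorphism poly_alg B -> poly_alg A}).
Context (phiK : cancel phi psi) (psiK : cancel psi phi).

Let delta : {linear poly_alg A -> poly_alg A} := psi \o @derivp k B \o phi.

Lemma transported_leibniz : leibniz delta.
Proof. by move=> f g; rewrite /= rmorphM derivp_leibniz rmorphD !rmorphM /= !phiK. Qed.

Lemma transported_iter n p : iter n delta p = psi (iter n (@derivp k B) (phi p)).
Proof. by elim: n => [|n IH]; rewrite ?phiK // !iterS IH /= psiK. Qed.

Lemma transported_loc_nilp : loc_nilp delta.
Proof.
move=> p; have [n hn] := derivp_loc_nilp (phi p); exists n.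
by rewrite transported_iter hn raddf0.
Qed.


Lemma derivp_const a : derivp (constp a : poly_alg B) = 0.
Proof. exact: derivC. Qed.

(** The image of A consists of constants of d/ds, that is, of elements of B.
    Conversely delta p = p' (delta t), so the kernel of delta is exactly A,
    and it must contain the image of B. *)
Lemma constants_preserved_iso : (forall a, delta (constp a) = 0) -> alg_iso A B.
Proof.
move=> hc.
have tfA := @pchar0_torsion_free k A ch; have tfB := @pchar0_torsion_free k B ch.
have phic a : phi (constp a) = constp (eval0 (phi (constp a))).
  apply: derivp_eq0 => //.
  by apply: (can_inj psiK); have := hc a; rewrite /= => ->; rewrite raddf0.
exists (@eval0 k B \o phi \o @constp k A).
exists (@eval0 k A \o psi \o @constp k B) => [a|b] /=.
  by rewrite -phic phiK constpK.
have E : psi (constp b) = constp (eval0 (psi (constp b))).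
  apply: derivp_eq0 => //.
  have := @leibniz_poly_deriv A delta (psi (constp b)) transported_leibniz hc.
  rewrite /= psiK derivp_const raddf0 => /esym/(poly_domain domA)[//|dX0].
  have := @leibniz_poly_deriv A delta (psi ('X : {poly B})) transported_leibniz hc.
  rewrite /= dX0 mulr0 psiK /derivp derivX rmorph1 => /eqP.
  by rewrite oner_eq0.
by rewrite -E psiK constpK.
Qed.

(** Finite generation is what bounds the t-degree of delta on A. *)
Lemma lnd_or_iso : affine A ->
  alg_iso A B \/
  exists d : {linear A -> A}, [/\ leibniz d, loc_nilp d & exists a, d a <> 0].
Proof.
move=> affA; have [/constants_preserved_iso|/existsNP[a0 ha0]] :=
  pselect (forall a, delta (constp a) = 0); [by left|right].
have bdd : exists N, forall a, (size (delta (constp a) : {poly A}) <= N)%N.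
  have [s hs] := (affineP A).1 affA.
  exists (\max_(x <- s) size (delta (constp x) : {poly A})); apply: hs.
  - by rewrite rmorph1 (leibniz1 transported_leibniz) size_poly0.
  - move=> c x y hx hy; rewrite !linearP /=.
    apply: leq_trans (size_polyD _ _) _; rewrite geq_max hy andbT.
    apply: leq_trans hx; apply/leq_sizeP => j hj.
    rewrite coef_scale nth_default ?scaler0 //.
  - move=> x y hx hy; rewrite rmorphM transported_leibniz /constp.
    apply: leq_trans (size_polyD _ _) _; rewrite geq_max.
    apply/andP; split.
      apply: leq_trans hx; apply/leq_sizeP => j hj.
      by rewrite coefMC nth_default ?mul0r.
    apply: leq_trans hy; apply/leq_sizeP => j hj.
    by rewrite coefCM nth_default ?mulr0.
  - by move=> x xs; apply: (@leq_bigmax_seq _ _ xpredT _ x).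
have [|D [dL dN [a da]]] := @leading_derivation A domA
  (pchar0_torsion_free ch) delta transported_leibniz transported_loc_nilp bdd.
  by exists a0.
pose d (x : A) : A := (delta (constp x) : {poly A})`_D.
have dlin : linear d.
  by move=> c x y; rewrite /d !linearP coefD coef_scale.
pose d' : {linear A -> A} := HB.pack d (GRing.isLinear.Build _ _ _ _ d dlin).
by exists d'; split => //; exists a.
Qed.
End LndOrIso.

(** B is a quotient of B[s], hence of A[t]. *)
Lemma affine_transfer (k : fieldType) (A B : algType k)
    (phi : {lrmorphism poly_alg A -> poly_alg B})
    (psi : {lrmorphism poly_alg B -> poly_alg A}) :
  cancel psi phi -> affine A -> affine B.
Proof.
move=> psiK /affineP[s hs]; apply/affineP.
exists (eval0 (phi ('X : {poly A})) :: [seq eval0 (phi (constp a)) | a <- s]).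
move=> P P1 Pl PM Ps b.
have PD x y : P x -> P y -> P (x + y).
  by move=> Px Py; rewrite -(scale1r x); exact: Pl.
have Pc a : P (eval0 (phi (constp a))).
  move: a; apply: hs => [|c x y|x y|x xs]; rewrite ?rmorph1 // ?linearP ?rmorphM /=.
  - exact: Pl.
  - exact: PM.
  - by apply: Ps; rewrite inE; apply/orP; right; apply/mapP; exists x.
suff Q (p : {poly A}) : P (eval0 (phi p)) by rewrite -(constpK b) -(psiK (constp b)).
elim/poly_ind: p => [|p a IH].
  by rewrite !raddf0 -(addNr 1) -scaleN1r; exact: Pl.
have -> : (p * 'X + a%:P : {poly A}) = (p : poly_alg A) * ('X : {poly A}) + constp a by [].
rewrite 2!rmorphD 2!rmorphM; apply: PD; last exact: Pc.
apply: PM => //.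
by apply: Ps; rewrite inE eqxx.
Qed.

(** * Linear dependence, dimension and the growth filtration *)

(** A division ring is needed only as a subset of an ambient ring, so that its
    elements act by left multiplication on the whole ring. *)
Record division_subring (R : nzRingType) (D : R -> Prop) : Prop := DivisionSubring {
  division1 : D 1;
  divisionB : forall x y, D x -> D y -> D (x - y);
  divisionM : forall x y, D x -> D y -> D (x * y);
  divisionV : forall x, D x -> x <> 0 -> exists2 y, D y & y * x = 1
}.

Section Dependence.
Context (R : nzRingType) (D : R -> Prop) (hD : division_subring D).

Lemma division0 : D 0.
Proof. by rewrite -(subrr 1); apply: (divisionB hD) => //; exact: (division1 hD). Qed.

Lemma divisionN x : D x -> D (- x).
Proof. by move=> hx; rewrite -sub0r; apply: (divisionB hD) => //; exact: division0. Qed.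

Lemma divisionD x y : D x -> D y -> D (x + y).
Proof. by move=> hx hy; rewrite -(opprK y); apply: (divisionB hD) => //; apply: divisionN. Qed.

Lemma division_sum I (r : seq I) (P : pred I) (F : I -> R) :
  (forall i, P i -> D (F i)) -> D (\sum_(i <- r | P i) F i).
Proof. by move=> hF; apply: big_ind => //; [exact: division0|exact: divisionD]. Qed.

(** Gaussian elimination with coefficients on the left: a row with an
    invertible entry in the first column clears that column in all the other
    rows. *)
Lemma division_dependence m n (M : 'I_n -> 'I_m -> R) :
    (m < n)%N -> (forall i j, D (M i j)) ->
  exists c : 'I_n -> R, [/\ forall i, D (c i), exists i, c i <> 0
    & forall j, \sum_i c i * M i j = 0].
Proof.
elim: m n M => [|m IH] [|n] M // lt hM.
  exists (fun=> 1); split=> [_||[]//]; first exact: (division1 hD).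
  by exists ord0; apply/eqP/oner_neq0.
have [col0|/existsNP[r /(divisionV hD (hM _ _))[u uD uM]]] :=
    pselect (forall i, M i ord0 = 0).
  have [|c [cD cn cM]] := IH n.+1 (fun i j => M i (lift ord0 j)) _ (fun i j => hM _ _).
    exact: ltnW.
  exists c; split=> // j; have [j' ->|->] := unliftP ord0 j; first exact: cM.
  by rewrite big1 // => i _; rewrite col0 mulr0.
pose M' i j := M (lift r i) (lift ord0 j) - M (lift r i) ord0 * u * M r (lift ord0 j).
have [//|i j|c [cD [i0 cn] cM]] := IH n M'.
  by apply: (divisionB hD) => //; apply: (divisionM hD) => //; apply: (divisionM hD).
pose e := - \sum_i c i * M (lift r i) ord0 * u.
exists (fun i => oapp c e (unlift r i)); split.
- move=> i; case: unliftP => [i' _|_] /=; first exact: cD.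
  apply: divisionN; apply: division_sum => i' _.
  by apply: (divisionM hD) => //; apply: (divisionM hD).
- by exists (lift r i0); rewrite liftK.
move=> j; rewrite (bigD1_ord r) //= unlift_none /=.
under eq_bigr => i _ do rewrite liftK /=.
rewrite /e mulNr mulr_suml addrC; apply/eqP; rewrite subr_eq0; apply/eqP.
have [j' ->|->] := unliftP ord0 j; last first.
  by apply: eq_bigr => i _; rewrite -!mulrA uM mulr1.
apply/eqP; rewrite -subr_eq0 -sumrB; apply/eqP; rewrite -[RHS](cM j').
by apply: eq_bigr => i _; rewrite /M' mulrBr !mulrA.
Qed.

(** Left inverses are two-sided because each has a left inverse in turn. *)
Lemma division_inverse x : D x -> x <> 0 -> exists y, [/\ D y, y * x = 1 & x * y = 1].
Proof.
move=> Dx x0; have [y Dy yx] := divisionV hD Dx x0; exists y; split => //.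
have y0 : y <> 0 by move=> y0; have /eqP := yx; rewrite y0 mul0r eq_sym oner_eq0.
have [z Dz zy] := divisionV hD Dy y0.
by rewrite -[x]mul1r -zy -(mulrA z) yx mulr1 zy.
Qed.
End Dependence.

Lemma field_division (k : fieldType) : division_subring (fun _ : k => True).
Proof.
by split=> // x _ x0; exists x^-1 => //; rewrite mulVf //; apply/eqP.
Qed.

Section Span.
Context (k : fieldType) (V : lmodType k).
Local Open Scope classical_set_scope.
Implicit Types (W X : set V).

Definition lin_subspace W := W 0 /\ forall (a : k) u v, W u -> W v -> W (a *: u + v).

Lemma submod_closedP W : GRing.submod_closed [in W] <-> lin_subspace W.
Proof.
split=> -[h0 h1]; split.
- by move: h0; rewrite inE.
- by move=> a u v hu hv; have := h1 a u v; rewrite !inE; exact.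
- by rewrite inE.
- by move=> a u v; rewrite !inE; exact: h1.
Qed.

Lemma lin_subspaceD W u v : lin_subspace W -> W u -> W v -> W (u + v).
Proof. by case=> _ h hu hv; rewrite -(scale1r u); apply: h. Qed.

Lemma lin_subspaceZ W a u : lin_subspace W -> W u -> W (a *: u).
Proof. by case=> h0 h hu; rewrite -(addr0 (a *: u)); apply: h. Qed.

Lemma lin_subspace_sum W I (r : seq I) (P : pred I) (F : I -> V) : lin_subspace W ->
  (forall i, P i -> W (F i)) -> W (\sum_(i <- r | P i) F i).
Proof.
move=> hW hF; apply: big_ind => //; first by case: hW.
by move=> x y; exact: lin_subspaceD.
Qed.

Lemma lspan_sub X : X `<=` lspan X.
Proof. by move=> x Xx M [_]; apply. Qed.

Lemma lspan_subspace X : lin_subspace (lspan X).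
Proof.
split=> [|a u v hu hv] M hM; have [/submod_closedP[M0 Ml] XM] := hM => //.
by apply: Ml; [apply: (hu M)|apply: (hv M)].
Qed.

Lemma lspan_min X W : lin_subspace W -> X `<=` W -> lspan X `<=` W.
Proof. by move=> hW XW x hx; apply: (hx W); split=> //; apply/submod_closedP. Qed.

Lemma lspan_ind X (P : V -> Prop) x : lspan X x ->
  P 0 -> (forall (a : k) u v, P u -> P v -> P (a *: u + v)) ->
  (forall x, X x -> P x) -> P x.
Proof. by move=> hx P0 Pl PX; apply: (@lspan_min X [set x | P x]). Qed.

Lemma lspan_rangeP n (v : 'I_n -> V) x :
  lspan (range v) x <-> exists c : 'I_n -> k, x = \sum_i c i *: v i.
Proof.
split=> [|[c ->]]; last first.
  apply: lin_subspace_sum => [|i _]; first exact: lspan_subspace.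
  by apply: (lin_subspaceZ _ (lspan_subspace (range v))); apply: lspan_sub; exists i.
apply: (@lspan_min (range v) [set x | exists c : 'I_n -> k, x = \sum_i c i *: v i]).
  split=> [|a _ _ [c ->] [c' ->]].
    by exists (fun=> 0); rewrite big1 // => i _; rewrite scale0r.
  exists (fun i => a * c i + c' i); rewrite scaler_sumr -big_split /=.
  by apply: eq_bigr => i _; rewrite scalerDl scalerA.
move=> _ [i _ <-]; exists (fun j => (j == i)%:R).
rewrite (bigD1 i) //= eqxx scale1r big1 ?addr0 // => j /negPf ->.
by rewrite scale0r.
Qed.

Lemma lspan_seqE (s : seq V) : lspan [set` s] = lspan (range (tnth (in_tuple s))).
Proof.
congr lspan; apply/seteqP; split=> [x /= xs|_ [i _ <-]] /=; last exact: mem_tnth.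
by have /tnthP[i ->] : x \in in_tuple s by []; exists i.
Qed.

Lemma lin_indep_leq m n (v : 'I_n -> V) (w : 'I_m -> V) :
  lin_indep v -> (forall i, lspan (range w) (v i)) -> (n <= m)%N.
Proof.
move=> vI vw; rewrite leqNgt; apply/negP => lt.
have /choice[M hM] i : exists c : 'I_m -> k, v i = \sum_j c j *: w j.
  exact/lspan_rangeP.
have [c [_ [i ci] cM]] := division_dependence (field_division k) lt (fun i j => I) (M := M).
apply: ci; apply: vI.
under eq_bigr => j _ do rewrite hM scaler_sumr.
rewrite exchange_big big1 //= => j _.
under eq_bigr => i' _ do rewrite scalerA.
by rewrite -scaler_suml cM scale0r.
Qed.

Lemma lin_indep_ext n (v : 'I_n -> V) w : lin_indep v -> ~ lspan (range v) w ->
  lin_indep (fun i : 'I_n.+1 => oapp v w (unlift ord_max i)).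
Proof.
move=> vI nw c; rewrite (bigD1_ord ord_max) //= unlift_none /=.
under eq_bigr => i _ do rewrite liftK /=.
have [c0|/eqP c0] := pselect (c ord_max = 0).
  rewrite c0 scale0r add0r => /vI cz i.
  by have [j ->|->//] := unliftP ord_max i.
move=> /eqP; rewrite addr_eq0 => /eqP cw; case: nw; apply/lspan_rangeP.
exists (fun i => - ((c ord_max)^-1 * c (lift ord_max i))).
rewrite -[w]scale1r -(mulVf c0) -scalerA cw scalerN scaler_sumr -sumrN.
by apply: eq_bigr => i _; rewrite scaleNr scalerA.
Qed.

(** A maximal independent family spans; it exists because independent families
    in W have at most m members. *)
Lemma lin_subspace_basis W m (w : 'I_m -> V) : lin_subspace W -> W `<=` lspan (range w) ->
  exists n (v : 'I_n -> V), is_basis W v.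
Proof.
move=> hW Ww.
pose Q n := `[< exists v : 'I_n -> V, lin_indep v /\ forall i, W (v i) >].
have ex : exists n, Q n.
  by exists 0%N; apply/asboolP; exists (fun=> 0); split=> [c _ []|[]].
have bd n : Q n -> (n <= m)%N.
  by case/asboolP=> v [vI vW]; apply: (lin_indep_leq vI) => i; apply: Ww.
case: (ex_maxnP ex bd) => n /asboolP[v [vI vW]] nmax; exists n, v; split=> //.
apply/seteqP; split=> [|x Wx]; first by apply: lspan_min => // _ [i _ <-].
apply: contrapT => nx; suff /nmax : Q n.+1 by rewrite ltnn.
apply/asboolP; exists (fun i => oapp v x (unlift ord_max i)).
split; first exact: lin_indep_ext.
by move=> i; have [j _|_] := unliftP ord_max i; [exact: vW|].
Qed.

(** The spanning family w is needed since ldim is zero on subspaces of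
    infinite dimension. *)
Lemma ldim_geq W m (w : 'I_m -> V) n (v : 'I_n -> V) :
    lin_subspace W -> W `<=` lspan (range w) ->
  lin_indep v -> (forall i, W (v i)) -> (n <= ldim W)%N.
Proof.
move=> hW Ww vI vW; have [b hb] := lin_subspace_basis hW Ww.
have [u [uI uW]] := @xgetI _ 0%N [set n | exists v : 'I_n -> V, is_basis W v] _ hb.
by apply: (lin_indep_leq (w := u) vI) => i; rewrite uW.
Qed.

Lemma ldim_leq W m (w : 'I_m -> V) : W `<=` lspan (range w) -> (ldim W <= m)%N.
Proof.
move=> Ww; rewrite /ldim; case: xgetP => [n _ [v [vI vW]]|//].
by apply: (lin_indep_leq (w := w) vI) => i; apply: Ww; rewrite -vW; apply: lspan_sub; exists i.
Qed.

End Span.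

Section Filtration.
Context (k : fieldType) (A : algType k).
Local Open Scope classical_set_scope.
Implicit Types (V W : set A) (s t : seq A).

Lemma set_mul_span s V W : V `<=` lspan [set` s] -> forall t, W `<=` lspan [set` t] ->
  set_mul V W `<=` lspan [set` [seq x * y | x <- s, y <- t]].
Proof.
move=> Vs t Wt; apply: lspan_min; first exact: lspan_subspace.
move=> _ [x [y [/Vs hx /Wt hy ->]]].
set L := lspan _; have [L0 Ll] : lin_subspace L by exact: lspan_subspace.
apply: (lspan_ind (P := fun x => L (x * y)) hx) => [|a u v hu hv|{hx}x xs].
- by rewrite mul0r.
- by rewrite mulrDl -scalerAl; exact: Ll.
apply: (lspan_ind (P := fun y => L (x * y)) hy) => [|a u v hu hv|{hy}y yt].
- by rewrite mulr0.
- by rewrite mulrDr -scalerAr; exact: Ll.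
by apply: lspan_sub; apply: allpairs_f.
Qed.

Lemma lspan_seqS s t : {subset s <= t} -> lspan [set` s] `<=` lspan [set` t].
Proof.
move=> st; apply: lspan_min; first exact: lspan_subspace.
by move=> x xs; apply: lspan_sub; apply: st.
Qed.

Lemma set_exp_span s V n : V `<=` lspan [set` s] ->
  exists t : seq A, set_exp V n `<=` lspan [set` t].
Proof.
move=> Vs; elim: n => [|n [t ht]] /=.
  exists [:: 1]; apply: lspan_min; first exact: lspan_subspace.
  by move=> _ ->; apply: lspan_sub; rewrite /= inE.
by exists [seq x * y | x <- s, y <- t]; exact: set_mul_span.
Qed.

(** Products of at most n elements of a finite spanning set span the n-th
    step. *)
Lemma filt_span V n : fin_dim V -> exists m (w : 'I_m -> A), filt V n `<=` lspan (range w).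
Proof.
case=> s Vs; suff [t ht] : exists t : seq A, filt V n `<=` lspan [set` t].
  by eexists; exists (tnth (in_tuple t)); rewrite -lspan_seqE.
have Vs' : V `<=` lspan [set` s] by rewrite Vs.
have /choice[f hf] i := set_exp_span i Vs'.
exists (flatten [seq f i | i <- iota 0 n.+1]).
apply: lspan_min; first exact: lspan_subspace.
move=> x [i lti /hf]; apply: lspan_seqS => y yf.
by apply/flattenP; exists (f i) => //; apply: map_f; rewrite mem_iota.
Qed.

Lemma filt_exp V n m x : (m <= n)%N -> set_exp V m x -> filt V n x.
Proof. by move=> le hx; apply: lspan_sub; exists m. Qed.

Lemma set_exp_mul V n x y : V x -> set_exp V n y -> set_exp V n.+1 (x * y).
Proof. by move=> hx hy; apply: lspan_sub; exists x, y. Qed.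

Lemma set_exp_pow V n m x y : V x -> V y -> set_exp V (n + m) (x ^+ n * y ^+ m).
Proof.
move=> hx hy; elim: n => [|n IH].
  rewrite expr0 mul1r; elim: m => [|m IH]; first exact: lspan_sub.
  by rewrite exprS; apply: set_exp_mul.
by rewrite exprS -mulrA addSn; apply: set_exp_mul.
Qed.

End Filtration.

(** * Gelfand-Kirillov dimension one forbids two parameters *)

(** The exponent 3/2 is any number strictly between 1 and 2. *)
Lemma ln_ratio_lt (R : realType) (d m : nat) : (1 < m)%N -> (0 < d)%N ->
  ln d%:R / ln m%:R < 3%:R / 2%:R :> R -> (d ^ 2 < m ^ 3)%N.
Proof.
move=> m1 d0.
have lm : 0 < ln m%:R :> R by apply: ln_gt0; rewrite ltr1n.
rewrite ltr_pdivrMr // mulrAC ltr_pdivlMr // -mulrC !mulr_natl.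
rewrite -!lnXn ?ltr0n //; last exact: ltnW.
by rewrite -!natrX ltr_ln ?posrE ?ltr0n ?expn_gt0 ?d0 ?(ltnW m1) // ltr_nat.
Qed.

(** If all the families y^i x^j, i, j < n, were independent, the step 2n of
    the filtration generated by x and y would have dimension at least n^2,
    which for large n exceeds (2n)^(3/2). *)
Lemma GKdim1_dependence (R : realType) (k : fieldType) (A : algType k) (x y : A) :
  GKdim A R = 1%E ->
  exists n (c : 'I_n -> 'I_n -> k),
    \sum_i \sum_j c i j *: (y ^+ i * x ^+ j) = 0 /\ exists i j, c i j <> 0.
Proof.
move=> GK; apply: contrapT => nodep.
pose V : set A := lspan [set` [:: y; x]]%classic.
have Vfin : fin_dim V by exists [:: y; x].
have lower n : (n ^ 2 <= ldim (filt V (n + n)))%N.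
  have [m [w hw]] := filt_span (n + n) Vfin.
  pose v (l : 'I_#|{: 'I_n * 'I_n}|) : A :=
    y ^+ (enum_val l).1 * x ^+ (enum_val l).2.
  suff : (#|{: 'I_n * 'I_n}| <= ldim (filt V (n + n)))%N.
    by rewrite card_prod card_ord mulnn.
  apply: (ldim_geq (v := v) _ hw) => [|c|l]; first exact: lspan_subspace.
    rewrite (reindex (@enum_rank _)) /=; last exact/onW_bij/enum_rank_bij.
    move=> c0 l; apply: contrapT => cl; apply: nodep.
    exists n, (fun i j => c (enum_rank (i, j))); split; last first.
      by exists (enum_val l).1, (enum_val l).2; rewrite -surjective_pairing enum_valK.
    rewrite pair_big -[RHS]c0; apply: eq_bigr => -[i j] _ /=.
    by rewrite /v enum_rankK.
  apply: (@filt_exp _ _ _ _ ((enum_val l).1 + (enum_val l).2)).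
    by apply: leq_add; apply: ltnW.
  by apply: set_exp_pow; apply: lspan_sub; rewrite /= !inE eqxx ?orbT.
have : (limn_esup (fun n => (ln (ldim (filt V n))%:R / ln n%:R : R)%:E)
        < (3%:R / 2%:R)%:E)%E.
  apply: (@le_lt_trans _ _ 1%E); last by rewrite lte_fin; lra.
  by rewrite -GK; apply: ereal_sup_ubound; exists V.
move=> /ereal_inf_lt[_ [S [N _ hN] <-] hS].
pose n := (N + 9)%N.
have : ln (ldim (filt V (n + n)))%:R / ln (n + n)%:R < 3%:R / 2%:R :> R.
  rewrite -lte_fin; apply: le_lt_trans hS; apply: ereal_sup_ubound.
  by exists (n + n)%N => //; apply: hN; rewrite /= /n; lia.
have := lower n; set d := ldim _ => hd.
have n9 : (8 < n)%N by rewrite /n; lia.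
have d0 : (0 < d)%N by apply: leq_trans hd; rewrite expn_gt0; lia.
have nn : (1 < n + n)%N by lia.
move/(ln_ratio_lt nn d0); apply/negP; rewrite -leqNgt.
apply: leq_trans (leq_mul hd hd).
by rewrite (_ : (n + n) ^ 3 = 8 * n ^ 3)%N -?expnD ?(expnS n 3) ?leq_mul2r; lia.
Qed.

(** * Slices with equal kernels *)

(** Divide a relation satisfied by y by the largest possible power of y; its
    constant term is then nonzero and gives the inverse. The predicate P
    records that the inverse stays in the subalgebra generated by y. *)
Lemma algebraic_inverse (k : fieldType) (A : algType k) (dom : is_domain A)
    (P : A -> Prop) (y : A) n (c : 'I_n -> k) :
    P 0 -> (forall a u v, P u -> P v -> P (a *: u + v)) -> (forall i, P (y ^+ i)) ->
    y <> 0 -> (exists i, c i <> 0) -> \sum_i c i *: y ^+ i = 0 ->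
  exists2 z, P z & z * y = 1.
Proof.
move=> P0 Pl Py y0; elim: n c => [|n IH] c [i ci]; first by case: i ci.
rewrite big_ord_recl expr0.
under eq_bigr => j _ do rewrite /bump /= exprSr scalerAl.
rewrite -mulr_suml; set r := \sum_(j < n) _ => cr.
have Pr : P r.
  apply: big_ind => // [u v Pu Pv|j _]; first by rewrite -(scale1r u); exact: Pl.
  by rewrite -[_ *: _]addr0; exact: Pl.
have [c0|/eqP c0] := pselect (c ord0 = 0).
  move: cr; rewrite c0 scale0r add0r => /dom[r0|//].
  apply: (IH (fun j => c (lift ord0 j))); last exact: r0.
  by have [j ij|ij] := unliftP ord0 i; [exists j; rewrite -ij|rewrite ij in ci].
exists (- (c ord0)^-1 *: r); first by rewrite -[_ *: _]addr0; exact: Pl.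
move/eqP: cr; rewrite addrC addr_eq0 => /eqP cr.
by rewrite -scalerAl cr scalerN scaleNr opprK scalerA mulVf ?scale1r.
Qed.

Section Kernel.
Context (k : fieldType) (A : algType k) (ch : [pchar k] =i pred0).
Context (dom : is_domain A) (d : {linear A -> A}).
Context (dL : leibniz d) (dN : loc_nilp d) (dn : exists a, d a <> 0).

Let tf : torsion_free A := pchar0_torsion_free ch.

(** An element y of the kernel and a local slice x satisfy a polynomial
    relation. Powers of x are independent over the kernel, so the relation is
    one for y alone: y is algebraic over k. *)
Lemma ker_division (R : realType) : GKdim A R = 1%E ->
  division_subring (fun y => d y = 0).
Proof.
move=> GK; split=> [|y z|y z|y].
- exact: leibniz1.
- by move=> hy hz; rewrite linearB /= hy hz subrr.
- exact: der_kerM.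
move=> dy y0; have [x dx ddx] := local_slice dN dn.
have [n [c [c0 [i0 [j0 cn]]]]] := GKdim1_dependence x y GK.
have col j : \sum_i c i j *: y ^+ i = 0.
  apply: (ker_free dom tf dL dN dx (c := fun j => \sum_i c i j *: y ^+ i)).
    move=> l /=; rewrite linear_sum big1 // => i _.
    by rewrite linearZ /= der_kerX ?scaler0.
  rewrite -[RHS]c0 exchange_big; apply: eq_bigr => l _.
  by rewrite mulr_suml; apply: eq_bigr => i _; rewrite scalerAl.
apply: (algebraic_inverse dom (P := fun z => d z = 0) (c := fun i => c i j0)) => //.
- exact: raddf0.
- by move=> a u v hu hv; rewrite linearP /= hu hv scaler0 addr0.
- by move=> i; exact: der_kerX.
- by exists i0.
Qed.

Lemma division_slice : division_subring (fun y => d y = 0) -> exists x, d x = 1.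
Proof.
move=> hD; have [x dx ddx] := local_slice dN dn.
have [e de eV] := divisionV hD ddx dx.
by exists (e * x); rewrite dL de mul0r add0r.
Qed.

End Kernel.

(** For a in the kernel, commutation with a commutes with d. *)
Lemma ker_commutator (R : nzRingType) (d : {additive R -> R}) n (z a : R) :
  leibniz d -> d a = 0 ->
  iter n d (z * a - a * z) = iter n d z * a - a * iter n d z.
Proof.
move=> dL da; elim: n => //= n ->.
by rewrite raddfB /= !dL da mul0r mulr0 add0r addr0.
Qed.

(** Multiplicativity of evaluation at a point that commutes with the constants
    of d. *)
Lemma horner_commute (R : nzRingType) (d : {additive R -> R}) (x : R) (p q : {poly R}) :
    (forall a, d a = 0 -> x * a = a * x) ->
  (forall i, d q`_i = 0) -> (p * q).[x] = p.[x] * q.[x].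
Proof.
move=> cx kq; apply: hornerM_comm.
rewrite /comm_poly horner_coef mulr_suml mulr_sumr; apply: eq_bigr => i _.
by rewrite -mulrA -exprSr exprS !mulrA cx.
Qed.

Lemma slice_neq0 (R : nzRingType) (d : R -> R) x : d x = 1 -> d x <> 0.
Proof. by move=> ->; apply/eqP/oner_neq0. Qed.

(** The algebra is then a polynomial ring over the kernel of d, with a central
    variable. *)
Definition central_slice (R : nzRingType) (d : R -> R) :=
  exists x, d x = 1 /\ forall a, d a = 0 -> x * a = a * x.

Lemma slice_commutator (R : nzRingType) (d : {additive R -> R}) x a :
  leibniz d -> d x = 1 -> d a = 0 -> d (x * a - a * x) = 0.
Proof.
by move=> dL dx da; have /= -> := ker_commutator 1 x dL da; rewrite dx mulr1 mul1r subrr.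
Qed.

(** Two algebras with locally nilpotent derivations whose kernels are
    identified by the restrictions of two algebra morphisms rho and tau. The
    situation is symmetric in A and B; rho and tau need not be inverse to each
    other outside the kernels. *)
Section Match.
Context (k : fieldType) (A B : algType k) (ch : [pchar k] =i pred0).
Context (domA : is_domain A) (domB : is_domain B).
Context (dA : {linear A -> A}) (dAL : leibniz dA) (dAN : loc_nilp dA).
Context (dB : {linear B -> B}) (dBL : leibniz dB) (dBN : loc_nilp dB).
Context (rho : {lrmorphism A -> B}) (tau : {lrmorphism B -> A}).
Context (rhoD : forall a, dA a = 0 -> dB (rho a) = 0).
Context (tauD : forall b, dB b = 0 -> dA (tau b) = 0).
Context (rhoK : forall a, dA a = 0 -> tau (rho a) = a).
Context (tauK : forall b, dB b = 0 -> rho (tau b) = b).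

Let tfA : torsion_free A := pchar0_torsion_free ch.
Let tfB : torsion_free B := pchar0_torsion_free ch.

(** Both algebras are polynomial rings over the common kernel; transport
    coefficients. *)
Lemma central_slices_iso (x : A) (y : B) :
    dA x = 1 -> dB y = 1 ->
    (forall a, dA a = 0 -> x * a = a * x) -> (forall b, dB b = 0 -> y * b = b * y) ->
  alg_iso A B.
Proof.
move=> dx dy cx cy.
have decA a : exists p : {poly A}, (forall i, dA p`_i = 0) /\ p.[x] = a.
  have [n hn] := dAN a.
  have [p [_ kp px]] := slice_expansion ch dAL dx hn.
  by exists p.
have decB b : exists p : {poly B}, (forall i, dB p`_i = 0) /\ p.[y] = b.
  have [n hn] := dBN b.
  have [p [_ kp px]] := slice_expansion ch dBL dy hn.
  by exists p.
have /choice[P hP] := decA; have /choice[Q hQ] := decB.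
have injA := horner_inj domA tfA dAL dAN (slice_neq0 dx).
have injB := horner_inj domB tfB dBL dBN (slice_neq0 dy).
(* The point y replaces x; multiplicativity holds because x and y commute
   with the coefficients. *)
pose f a := (map_poly rho (P a)).[y].
have fE (p : {poly A}) : (forall i, dA p`_i = 0) -> f p.[x] = (map_poly rho p).[y].
  move=> kp; have [kP eP] := hP p.[x].
  by rewrite /f (injA _ _ kP kp eP).
have PK a i : dA (P a)`_i = 0 by case: (hP a).
have PE a : (P a).[x] = a by case: (hP a).
have flin : linear f.
  move=> c a b; rewrite -{1}(PE a) -{1}(PE b) -mulr_algl -hornerCM -hornerD fE.
    by rewrite rmorphD rmorphM /= map_polyC /= hornerD hornerCM linearZ rmorph1 mulr_algl.
  move=> i; rewrite coefD coefCM mulr_algl linearP /=.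
  by rewrite !PK scaler0 addr0.
have fmul : monoid_morphism f.
  split=> [|a b].
    rewrite -(hornerC 1 x) fE ?map_polyC ?hornerC /= ?rmorph1 // => i.
    by rewrite coefC; case: eqP => _; rewrite ?leibniz1 ?raddf0.
  rewrite -{1}(PE a) -{1}(PE b) -(@horner_commute _ dA _ _ _ cx (PK b)) fE.
    rewrite rmorphM (@horner_commute _ dB _ _ _ cy) // => i.
    by rewrite coef_map; apply: rhoD.
  move=> i; rewrite coefM linear_sum big1 // => j _.
  exact: (der_kerM dAL (PK _ _) (PK _ _)).
pose f' : {lrmorphism A -> B} := HB.pack f
  (GRing.isLinear.Build _ _ _ _ f flin) (GRing.isMonoidMorphism.Build _ _ f fmul).
exists f'.
pose g b := (map_poly tau (Q b)).[x].
have QK b i : dB (Q b)`_i = 0 by case: (hQ b).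
exists g => [a|b] /=.
  have QP : Q (f a) = map_poly rho (P a).
    apply: injB => //; last by case: (hQ (f a)).
      exact: QK.
    by move=> i; rewrite coef_map; apply: rhoD.
  rewrite /g QP -[RHS](PE a); congr (_.[x]); apply/polyP => i.
  by rewrite !coef_map /= rhoK.
rewrite fE => [|i]; last by rewrite coef_map /= tauD.
have [_ {2}<-] := hQ b; congr (_.[y]); apply/polyP => i.
by rewrite !coef_map /= tauK.
Qed.

(** Write tau y as a polynomial P in the central slice x. For a in the kernel,
    [tau y, a] lies in the kernel, so it equals the commutator of a with the
    constant coefficient of P. Subtracting that coefficient from y makes it
    central. *)
Lemma central_slice_transfer (y : B) :
  dB y = 1 -> central_slice dA -> central_slice dB.
Proof.
move=> dy [x [dx cx]].
have [n hn] := dAN (tau y).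
have [P [_ kP Px]] := slice_expansion ch dAL dx hn.
exists (y - rho P`_0); split; first by rewrite linearB /= dy rhoD ?subr0.
move=> b kb; set a := tau b; have ka : dA a = 0 by exact: tauD.
have kC : forall i, dA (a%:P)`_i = 0.
  by move=> i; rewrite coefC; case: eqP => _ //; rewrite raddf0.
have kyb := slice_commutator dBL dy kb.
have tE : tau (y * b - b * y) = (P * a%:P - a%:P * P).[x].
  by rewrite hornerD hornerN hornerCM (@horner_commute _ dA _ _ _ cx kC) hornerC Px rmorphB !rmorphM.
have QE : P * a%:P - a%:P * P = (tau (y * b - b * y))%:P.
  apply: (horner_inj domA tfA dAL dAN (slice_neq0 dx)).
  - move=> i; rewrite coefB coefMC coefCM raddfB /=.
    by rewrite (der_kerM dAL (kP i) ka) (der_kerM dAL ka (kP i)) subrr.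
  - by move=> i; rewrite coefC; case: eqP => _; [exact: tauD|exact: raddf0].
  - by rewrite hornerC.
have := congr1 (fun p : {poly A} => rho p`_0) QE.
rewrite coefB coefMC coefCM coefC /= tauK // rmorphB !rmorphM /= tauK // => E.
have yb : y * b = rho P`_0 * b - b * rho P`_0 + b * y by rewrite E subrK.
by rewrite mulrBl mulrBr yb addrAC (addrC (_ * b)) addrK addrC.
Qed.

(** In this case tau y is itself a local slice whose derivative is invertible,
    so tau maps expansions in powers of y to expansions in powers of tau y,
    coefficient by coefficient. *)
Lemma degree_one_iso (y : B) : dB y = 1 ->
    dA (tau y) <> 0 -> dA (dA (tau y)) = 0 -> division_subring (fun a => dA a = 0) ->
  alg_iso B A.
Proof.
move=> dy zn zn1 hD; set z := tau y in zn zn1.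
have [e [ke ez ze]] := division_inverse hD zn1 zn.
have tau_inj : injective tau.
  apply: raddf_inj => b tb; have [n hn] := dBN b.
  have [Q [_ kQ Qy]] := slice_expansion ch dBL dy hn.
  suff Q0 : map_poly tau Q = 0.
    rewrite -Qy (_ : Q = 0) ?horner0 //; apply/polyP => i.
    by rewrite coef0 -(tauK (kQ i)) -coef_map Q0 coef0 raddf0.
  apply: (ker_transcendental domA tfA dAL dAN zn).
    by move=> i; rewrite coef_map; apply: tauD.
  by rewrite /z horner_map Qy tb.
have tau_surj a : exists b, tau b = a.
  have [n hn] := dAN a.
  have [P [_ kP Pz]] := slice_decomposition ch dAL zn1 ke ez hn.
  exists (map_poly rho P).[y]; rewrite -horner_map -[RHS]Pz; congr (_.[_]).
  by apply/polyP => i; rewrite !coef_map /= rhoK.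
have /choice[g gK] := tau_surj.
by exists tau; exists g => // b; apply: tau_inj; rewrite gK.
Qed.

(** The three cases are those where tau y has order one, at least two, and
    zero with respect to dA. For order n > 1 apply dA^(n-1) to [tau y, a],
    which lies in the kernel: the local slice dA^(n-1) (tau y) commutes with
    the kernel. *)
Lemma match_trichotomy (y : B) :
    division_subring (fun a => dA a = 0) -> dB y = 1 ->
  alg_iso B A \/ central_slice dA \/ central_slice dB.
Proof.
move=> hD dy; set z := tau y.
have dz a : dA a = 0 -> dA (z * a - a * z) = 0.
  move=> ka; rewrite -(rhoK ka) /z -!rmorphM -rmorphB; apply: tauD.
  by apply: slice_commutator => //; exact: rhoD.
have [kz|zn0] := pselect (dA z = 0).
  right; right; exists (y - rho z); split; first by rewrite linearB /= dy rhoD ?subr0.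
  move=> b kb; have kyb := slice_commutator dBL dy kb.
  have : rho (tau (y * b - b * y)) = rho (z * tau b - tau b * z).
    by rewrite [tau _]rmorphB !rmorphM.
  rewrite (tauK kyb) rmorphB !rmorphM /= (tauK kb) => /eqP; rewrite subr_eq => /eqP yb.
  by rewrite mulrBl mulrBr yb addrAC (addrC (_ * b)) addrK addrC.
have z0 : z <> 0 by move=> z0; apply: zn0; rewrite z0 raddf0.
have [[|[|n]] zn zn1] := lnd_order dAN z0; first by [].
  by left; exact: (degree_one_iso dy).
right; left; set w := iter n.+1 dA z.
have kdw : dA (dA w) = 0 by exact: zn1.
have [e [ke ew we]] := division_inverse hD kdw zn.
have cw a : dA a = 0 -> w * a = a * w.
  move=> ka; apply/eqP; rewrite -subr_eq0 -(ker_commutator n.+1 z dAL ka).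
  by rewrite iterSr /= dz // iter_raddf0.
have ce a : dA a = 0 -> dA w * a = a * dA w.
  move=> ka; have := congr1 dA (cw a ka).
  by rewrite !dAL ka mulr0 mul0r addr0 add0r.
have ce' a : dA a = 0 -> e * a = a * e.
  move=> ka; rewrite -[LHS]mulr1 -we -mulrA (mulrA a) -ce // !mulrA.
  by rewrite ew mul1r.
exists (e * w); split; first by rewrite dAL ke mul0r add0r.
by move=> a ka; rewrite -mulrA cw // !mulrA ce'.
Qed.
End Match.

(** * Cancellation in characteristic zero *)

Section BiDegree.
Context (R : nzRingType) (d : {additive R -> R}) (dL : leibniz d) (dN : loc_nilp d).

(** When d has a slice x, this bounds the degrees in t and in x by m. *)
Definition bidegree_le m (p : {poly R}) :=
  (size p <= m.+1)%N /\ forall i, iter m.+1 d p`_i = 0.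

Lemma bidegree_leW m n p : (m <= n)%N -> bidegree_le m p -> bidegree_le n p.
Proof.
move=> le [sp dp]; split=> [|i]; first exact: leq_trans sp _.
exact: (iter_eq0_leq (m := m.+1)).
Qed.

Lemma bidegree_leM m n p q :
  bidegree_le m p -> bidegree_le n q -> bidegree_le (m + n) (p * q).
Proof.
move=> [sp dp] [sq dq]; split=> [|i].
  by apply: leq_trans (size_polyMleq _ _) _; lia.
by rewrite coefM iter_raddf_sum big1 // => j _; apply: iter_mul_eq0.
Qed.

Lemma bidegree_leX m p i : bidegree_le m p -> bidegree_le (m * i) (p ^+ i).
Proof.
move=> hp; elim: i => [|i IH]; last by rewrite exprS mulnS; exact: bidegree_leM.
rewrite muln0 expr0; split=> [|j]; first by rewrite size_poly1.
by rewrite coef1 /=; case: eqP => _; rewrite ?leibniz1 ?raddf0.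
Qed.

Lemma bidegree_le_ex p : exists m, bidegree_le m p.
Proof.
have /choice[f hf] := dN.
exists (size p + \sum_(i < size p) f (p`_i)%R)%N; split=> [|i]; first by lia.
have [lt|ge] := ltnP i (size p); last by rewrite nth_default ?iter_raddf0.
apply: (iter_eq0_leq _ (hf p`_i)).
by rewrite (bigD1 (Ordinal lt)) //=; lia.
Qed.

End BiDegree.

Lemma sum_triple (V : zmodType) (I J L : finType) (G : I * J * L -> V) :
  \sum_t G t = \sum_l \sum_j \sum_i G (i, j, l).
Proof.
rewrite (eq_bigr (fun t => G (t.1.1, t.1.2, t.2))); last by case=> -[].
rewrite -(pair_bigA _ (fun u l => G (u.1, u.2, l))) exchange_big.
apply: eq_bigr => l _ /=.
by rewrite -(pair_bigA _ (fun i j => G (i, j, l))) exchange_big.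
Qed.

Section Kernels.
Context (k : fieldType) (A B : algType k) (ch : [pchar k] =i pred0).
Context (domA : is_domain A) (domB : is_domain B).
Context (phi : {lrmorphism poly_alg A -> poly_alg B}).
Context (psi : {lrmorphism poly_alg B -> poly_alg A}).
Context (phiK : cancel phi psi) (psiK : cancel psi phi).
Context (dA : {linear A -> A}) (dAL : leibniz dA) (dAN : loc_nilp dA).
Context (dB : {linear B -> B}) (dBL : leibniz dB) (dBN : loc_nilp dB).
Context (hD : division_subring (fun a => dA a = 0)).

Let tfA : torsion_free A := pchar0_torsion_free ch.
Let tfB : torsion_free B := pchar0_torsion_free ch.
Let rho : {lrmorphism A -> B} := @eval0 k B \o phi \o @constp k A.
Let tau : {lrmorphism B -> A} := @eval0 k A \o psi \o @constp k B.

(** Nonzero elements of the kernel are units, and units are killed by every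
    locally nilpotent derivation: by d/ds on B[s], then by dB. *)
Lemma ker_image a : dA a = 0 -> phi (constp a) = constp (rho a) /\ dB (rho a) = 0.
Proof.
move=> ka; have [->|a0] := pselect (a = 0); first by rewrite !raddf0.
have [b [kb ba ab]] := division_inverse hD ka a0.
have E u v : u * v = 1 -> phi (constp u) = constp (rho u).
  move=> uv; apply: (derivp_eq0 tfB).
  apply: (lnd_unit (poly_domain domB) (poly_torsion_free tfB) (derivp_leibniz (A := B))
    (@derivp_loc_nilp k B) (v := phi (constp v))).
  by rewrite -rmorphM -rmorphM uv !rmorph1.
split; first exact: E ab.
by apply: (lnd_unit domB tfB dBL dBN (v := rho b)); rewrite -rmorphM ab rmorph1.
Qed.

(** Counting argument. If b had a preimage outside the kernel of dA, its
    powers would be left independent over that kernel, and then so would the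
    n^3 monomials b^i y^j s^l with exponents below n: separate successively by
    s-degree, by powers of y and by powers of b. Their preimages have degree
    at most m = O(n) in both t and x, hence lie in a left space spanned by
    (m+1)^2 monomials. *)
Lemma ker_preimage (x : A) (y : B) b : dA x = 1 -> dB y <> 0 -> dB b = 0 ->
  psi (constp b) = constp (tau b) /\ dA (tau b) = 0.
Proof.
move=> dx dy kb; apply: contrapT => nb.
pose beta := psi (constp b); pose xi := psi (constp y); pose sigma := psi ('X : {poly B}).
have beta_free n (c : 'I_n -> A) : (forall i, dA (c i) = 0) ->
    \sum_i constp (c i) * beta ^+ i = 0 -> forall i, c i = 0.
  move=> kc c0; have [db|db] := pselect (derivp beta = 0).
    (* If beta has degree zero in t, it is an element of A outside the kernel
       of dA. *)
    have betaE := derivp_eq0 tfA db.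
    apply: (ker_free domA tfA dAL dAN (z := eval0 beta)) => [tb|//|].
      by apply: nb; rewrite -betaE.
    have := congr1 (@eval0 k A) c0; rewrite rmorph0 rmorph_sum => h; rewrite -[RHS]h.
    by apply: eq_bigr => i _; rewrite rmorphM rmorphXn /= constpK.
  (* If beta has positive degree in t, compare degrees in t. *)
  move=> i; apply: (can_inj (@constpK k A)); rewrite raddf0; move: i.
  apply: (ker_free (poly_domain domA) (poly_torsion_free tfA) (@derivp_leibniz k A)
    (@derivp_loc_nilp k A) db (c := fun i => constp (c i))) => [i|//].
  exact: derivC.
have [N [Nb Ny Nx]] : exists N, [/\ bidegree_le dA N beta, bidegree_le dA N xi
    & bidegree_le dA N sigma].
  have [m1 h1] := bidegree_le_ex dAN beta; have [m2 h2] := bidegree_le_ex dAN xi.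
  have [m3 h3] := bidegree_le_ex dAN sigma.
  by exists (m1 + m2 + m3)%N; split; [move: h1|move: h2|move: h3];
    apply: bidegree_leW; lia.
(* With m = 3 n N one has (m + 1)^2 <= (3 n (N + 1))^2 = 9 (N + 1)^2 n^2 <
   n^3. *)
pose n := (9 * N.+1 ^ 2).+1.
pose m := (3 * n * N)%N.
pose mono (t : 'I_n * 'I_n * 'I_n) := beta ^+ t.1.1 * xi ^+ t.1.2 * sigma ^+ t.2.
have mono_le t : bidegree_le dA m (mono t).
  apply: (@bidegree_leW _ _ (N * t.1.1 + N * t.1.2 + N * t.2)).
    have := ltn_ord t.1.1; have := ltn_ord t.1.2; have := ltn_ord t.2.
    by rewrite /m -!mulnDr mulnC leq_mul2r; lia.
  by apply: bidegree_leM => //; first apply: bidegree_leM => //; exact: bidegree_leX.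
have coord t i : exists p : {poly A},
    [/\ (size p <= m.+1)%N, forall j, dA p`_j = 0 & p.[x] = (mono t : {poly A})`_i].
  have [_ /(_ i) hi] := mono_le t.
  have [p hp] := slice_expansion ch dAL dx hi.
  by exists p.
have /choice[P hP] := fun ti : ('I_n * 'I_n * 'I_n) * nat => coord ti.1 ti.2.
pose T : finType := ('I_n * 'I_n * 'I_n)%type; pose S : finType := ('I_m.+1 * 'I_m.+1)%type.
pose M (l : 'I_#|T|) (s : 'I_#|S|) : A :=
  (P (enum_val l, (enum_val s).1 : nat))`_(enum_val s).2.
have lt : (#|S| < #|T|)%N.
  rewrite !card_prod !card_ord.
  have h : (m.+1 <= n * (3 * N.+1))%N by rewrite /m mulnAC; nia.
  apply: leq_ltn_trans (leq_mul h h) _.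
  by rewrite mulnACA -[X in (_ < X)%N]mulnA mulnC ltn_pmul2r /n; nia.
have [|c [kc [l0 cl0] cM]] := division_dependence hD lt (M := M).
  by move=> l s; rewrite /M; case: (hP (enum_val l, (enum_val s).1 : nat)).
apply: cl0.
pose C i j l := c (enum_rank (i, j, l)).
suff C0 i j l : C i j l = 0.
  by rewrite -[l0]enum_valK; case: (enum_val l0) => -[i j] l; exact: C0.
have rel : \sum_l constp (c l) * mono (enum_val l) = 0.
  apply/polyP => u; rewrite coef_sum coef0.
  under eq_bigr => r _ do rewrite coefCM.
  have [lu|gu] := ltnP u m.+1; last first.
    rewrite big1 // => r _; have [sr _] := mono_le (enum_val r).
    by rewrite nth_default ?mulr0 //; apply: leq_trans sr gu.
  under eq_bigr => r _.
    have [sr _ <-] := hP (enum_val r, u).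
    rewrite (horner_coef_wide _ sr) mulr_sumr.
    under eq_bigr => s _ do rewrite mulrA.
    over.
  rewrite exchange_big big1 //= => s _; rewrite -mulr_suml.
  have := cM (enum_rank (Ordinal lu, s)).
  rewrite /M enum_rankK /= => ->.
  by rewrite mul0r.
have {}rel : \sum_l constp (\sum_j (\sum_i rho (C i j l) * b ^+ i) * y ^+ j)
    * ('X : {poly B}) ^+ l = 0 :> poly_alg B.
  have := congr1 phi rel; rewrite rmorph0 rmorph_sum => h; rewrite -[RHS]h.
  rewrite [RHS](reindex (@enum_rank T)) /=; last exact/onW_bij/enum_rank_bij.
  under [RHS]eq_bigr => t _ do rewrite enum_rankK.
  rewrite sum_triple; apply: eq_bigr => r _.
  rewrite rmorph_sum mulr_suml; apply: eq_bigr => v _.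
  rewrite rmorphM rmorph_sum !mulr_suml; apply: eq_bigr => u _.
  have [E _] := ker_image (kc (enum_rank (u, v, r))).
  by rewrite /mono !rmorphM !rmorphXn /= !psiK /C E constpK !mulrA.
have dX : @derivp k B ('X : {poly B}) <> 0.
  by rewrite /derivp derivX; apply/eqP/oner_neq0.
have {}rel := ker_free (poly_domain domB) (poly_torsion_free tfB) (@derivp_leibniz k B)
  (@derivp_loc_nilp k B) dX (fun r => derivC _) rel.
have {}rel r : \sum_j (\sum_i rho (C i j r) * b ^+ i) * y ^+ j = 0.
  by apply: (can_inj (@constpK k B)); rewrite raddf0; exact: rel.
have krho r : dB (rho (c r)) = 0 by case: (ker_image (kc r)).
have {}rel v : \sum_i rho (C i v l) * b ^+ i = 0.
  apply: (ker_free domB tfB dBL dBN dy (c := fun v => \sum_i rho (C i v l) * b ^+ i)).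
    move=> v' /=; rewrite linear_sum big1 // => u _.
    by apply: (der_kerM dBL); [exact: krho|exact: der_kerX].
  exact: rel.
apply: (beta_free n (fun u => C u j l)) => [u|]; first exact: kc.
have := congr1 (fun w => psi (constp w)) (rel j); rewrite !rmorph0 !rmorph_sum /= => h; rewrite -[RHS]h.
apply: eq_bigr => u _; rewrite !rmorphM !rmorphXn /=.
have E : phi (constp (C u j l)) = constp (eval0 (phi (constp (C u j l)))).
  by case: (ker_image (kc (enum_rank (u, j, l)))).
by rewrite -E phiK.
Qed.
End Kernels.

(** B embeds into A[t]. *)
Lemma const_domain (k : fieldType) (A B : algType k)
    (phi : {lrmorphism poly_alg A -> poly_alg B})
    (psi : {lrmorphism poly_alg B -> poly_alg A}) :
  cancel psi phi -> is_domain A -> is_domain B.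
Proof.
move=> psiK domA x y xy.
have inj b : psi (constp b) = 0 -> b = 0.
  by move/(congr1 phi); rewrite psiK raddf0 => /(congr1 (@eval0 k B)); rewrite constpK raddf0.
have : psi (constp x) * psi (constp y) = 0 by rewrite -!rmorphM xy !raddf0.
by case/(poly_domain domA) => /inj; [left|right].
Qed.

Lemma cancellation_GKdim1 (R : realType) (k : fieldType) (A : algType k) :
  [pchar k] =i pred0 -> affine A -> is_domain A -> GKdim A R = 1%E -> cancellative A.
Proof.
move=> ch affA domA GK B [phi /lrmorphism_inverse[psi [phiK psiK]]].
have domB := const_domain psiK domA.
have affB := affine_transfer psiK affA.
have [//|[dA [dAL dAN nA]]] := lnd_or_iso ch domA phiK psiK affA.
have [/alg_iso_sym//|[dB [dBL dBN nB]]] := lnd_or_iso ch domB psiK phiK affB.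
have hD := ker_division ch domA dAL dAN nA GK.
have [x dx] := division_slice dAL dAN nA hD.
have [y0 dy0 ddy0] := local_slice dBN nB.
pose rho : {lrmorphism A -> B} := @eval0 k B \o phi \o @constp k A.
pose tau : {lrmorphism B -> A} := @eval0 k A \o psi \o @constp k B.
have hA a : dA a = 0 -> phi (constp a) = constp (rho a) /\ dB (rho a) = 0.
  exact: (ker_image ch domB phi dBL dBN hD).
have hB b : dB b = 0 -> psi (constp b) = constp (tau b) /\ dA (tau b) = 0.
  exact: (ker_preimage ch domA domB phiK psiK dAL dAN dBL dBN hD dx dy0).
have rhoD a : dA a = 0 -> dB (rho a) = 0 by case/hA.
have tauD b : dB b = 0 -> dA (tau b) = 0 by case/hB.
have rhoK a : dA a = 0 -> tau (rho a) = a.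
  by case/hA=> E _; rewrite /tau /= -E phiK constpK.
have tauK b : dB b = 0 -> rho (tau b) = b.
  by case/hB=> E _; rewrite /rho /= -E psiK constpK.
have [y dy] : exists y, dB y = 1.
  have [] := divisionV hD (tauD _ ddy0) => [t0|e ke eV].
    by apply: dy0; rewrite -(tauK _ ddy0) t0 raddf0.
  exists (rho e * y0); rewrite dBL rhoD // mul0r add0r.
  by rewrite -{1}(tauK _ ddy0) -rmorphM eV rmorph1.
have both : central_slice dA -> central_slice dB -> alg_iso A B.
  move=> [x' [dx' cx]] [y' [dy' cy]].
  exact: (central_slices_iso ch domA domB dAL dAN dBL dBN rhoD tauD rhoK tauK dx' dy').
have [/alg_iso_sym//|[cA|cB]] :=
  match_trichotomy ch domA dAL dAN dBL dBN rhoD tauD rhoK tauK hD dy.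
  apply: both => //.
  exact: (central_slice_transfer ch domA dAL dAN dBL rhoD tauD tauK dy).
apply: both => //.
exact: (central_slice_transfer ch domB dBL dBN dAL tauD rhoD rhoK dx).
Qed.

(** * Ore extensions of derivation type *)

(** A field extension of k with a k-linear derivation, bundled so that the Ore
    extension is a type depending on one parameter. *)
Record diff_field (k : fieldType) := DiffField {
  df_field :> fieldType;
  df_in : {rmorphism k -> df_field};
  df_der : {additive df_field -> df_field};
  df_leibniz : leibniz df_der;
  df_const : forall c, df_der (df_in c) = 0
}.

Section Ore.
Context (k : fieldType) (K : diff_field k).

(** Polynomials with coefficients on the left; only the product differs from
    that of {poly K}. *)
Definition ore : Type := {poly K}.
HB.instance Definition _ := GRing.Zmodule.on ore.

Let delta := df_der K.

(** Left multiplication by the variable: moving x past the coefficients of q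
    produces their derivatives. *)
Definition ore_shift (q : {poly K}) : {poly K} := 'X * q + map_poly delta q.

Fact ore_shift_additive : zmod_morphism ore_shift.
Proof. by move=> p q; rewrite /ore_shift mulrBr raddfB opprD addrACA. Qed.
HB.instance Definition _ := GRing.isZmodMorphism.Build _ _ ore_shift ore_shift_additive.

Lemma iter_ore_shiftD n (p q : {poly K}) : iter n ore_shift (p + q) = iter n ore_shift p + iter n ore_shift q.
Proof. exact: iter_raddfD. Qed.

Lemma ore_shiftZ a (q : {poly K}) : ore_shift (a *: q) = a *: ore_shift q + delta a *: q.
Proof.
rewrite /ore_shift scalerDr -scalerAr -addrA; congr (_ + _); apply/polyP => i.
by rewrite coefD !coefZ !coef_map coefZ df_leibniz addrC.
Qed.

Lemma ore_shiftXn n : ore_shift 'X^n = 'X^(n.+1).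
Proof.
rewrite /ore_shift -exprS; apply/polyP => i.
rewrite coefD coef_map /= [in X in _ + X]coefXn.
by case: (_ == _); rewrite ?(leibniz1 (@df_leibniz _ K)) ?raddf0 addr0.
Qed.

Definition ore_mul (p q : {poly K}) : {poly K} :=
  \sum_(i < size p) p`_i *: iter i ore_shift q.

Lemma ore_mulE n (p q : {poly K}) : (size p <= n)%N ->
  ore_mul p q = \sum_(i < n) p`_i *: iter i ore_shift q.
Proof.
move=> le; rewrite /ore_mul (big_ord_widen n (fun i => p`_i *: iter i ore_shift q)) //.
rewrite [LHS]big_mkcond; apply: eq_bigr => i _.
by case: ltnP => // ge; rewrite nth_default ?scale0r.
Qed.

Lemma ore_mulDl p p' q : ore_mul (p + p') q = ore_mul p q + ore_mul p' q.
Proof.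
pose n := maxn (size p) (size p').
rewrite !(@ore_mulE n) ?leq_maxl ?leq_maxr ?size_polyD // -big_split.
by apply: eq_bigr => i _; rewrite coefD scalerDl.
Qed.

Lemma ore_mulZl a (p q : {poly K}) : ore_mul (a *: p) q = a *: ore_mul p q.
Proof.
rewrite (ore_mulE q (size_scale_leq a p)) /ore_mul scaler_sumr.
by apply: eq_bigr => i _; rewrite coefZ scalerA.
Qed.

Lemma ore_mulDr p q q' : ore_mul p (q + q') = ore_mul p q + ore_mul p q'.
Proof.
rewrite /ore_mul -big_split; apply: eq_bigr => i _.
by rewrite iter_ore_shiftD scalerDr.
Qed.

Lemma ore_mulXn n q : ore_mul 'X^n q = iter n ore_shift q.
Proof.
rewrite (@ore_mulE n.+1) ?size_polyXn // (bigD1 ord_max) //= coefXn eqxx scale1r.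
rewrite big1 ?addr0 // => i; rewrite -val_eqE /= coefXn => /negPf ->.
by rewrite scale0r.
Qed.

Lemma ore_ind (P : {poly K} -> Prop) : P 0 -> (forall p q, P p -> P q -> P (p + q)) ->
  (forall a n, P (a *: 'X^n)) -> forall p, P p.
Proof.
by move=> P0 PD PX p; rewrite -(coefK p) poly_def; apply: big_ind.
Qed.

Lemma ore_mul0l q : ore_mul 0 q = 0.
Proof. by rewrite /ore_mul size_poly0 big_ord0. Qed.

(** This is associativity for the variable, and it is where the Leibniz rule
    enters. *)
Lemma ore_mul_shift q r : ore_mul (ore_shift q) r = ore_shift (ore_mul q r).
Proof.
elim/ore_ind: q => [|p q hp hq|a n].
- by rewrite raddf0 /= ore_mul0l raddf0.
- by rewrite raddfD /= (ore_mulDl (ore_shift p)) hp hq (ore_mulDl p) raddfD.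
by rewrite ore_shiftZ (ore_mulDl (a *: _)) !ore_mulZl ore_shiftXn !ore_mulXn ore_shiftZ.
Qed.

Lemma ore_mul_iter n q r : ore_mul (iter n ore_shift q) r = iter n ore_shift (ore_mul q r).
Proof. by elim: n => //= n IH; rewrite ore_mul_shift IH. Qed.

Fact ore_mulA : associative ore_mul.
Proof.
move=> p q r; elim/ore_ind: p => [|p p' hp hp'|a n].
- by rewrite !ore_mul0l.
- by rewrite !ore_mulDl hp hp'.
by rewrite !ore_mulZl !ore_mulXn ore_mul_iter.
Qed.

Fact ore_mul1l : left_id 1 ore_mul.
Proof. by move=> p; rewrite -(expr0 'X) ore_mulXn. Qed.

Fact ore_mul1r : right_id 1 ore_mul.
Proof.
move=> p; elim/ore_ind: p => [|p p' hp hp'|a n]; first exact: ore_mul0l.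
  by rewrite ore_mulDl hp hp'.
rewrite ore_mulZl ore_mulXn; congr (_ *: _).
by elim: n => [|n IH]; rewrite ?expr0 //= IH ore_shiftXn.
Qed.

HB.instance Definition _ := GRing.Zmodule_isNzRing.Build ore
  ore_mulA ore_mul1l ore_mul1r (fun p p' q => ore_mulDl p p' q) ore_mulDr
  (@oner_neq0 {poly K}).

Definition ore_scale (c : k) (p : ore) : ore := df_in K c *: (p : {poly K}).

Fact ore_scaleA a b p : ore_scale a (ore_scale b p) = ore_scale (a * b) p.
Proof. by rewrite /ore_scale scalerA rmorphM. Qed.
Fact ore_scale1 : left_id 1 ore_scale.
Proof. by move=> p; rewrite /ore_scale rmorph1 scale1r. Qed.
Fact ore_scaleDr : right_distributive ore_scale +%R.
Proof. by move=> a p q; rewrite /ore_scale scalerDr. Qed.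
Fact ore_scaleDl p : {morph ore_scale^~ p : a b / a + b >-> a + b}.
Proof. by move=> a b; rewrite /ore_scale rmorphD scalerDl. Qed.

HB.instance Definition _ := GRing.Zmodule_isLmodule.Build k ore
  ore_scaleA ore_scale1 ore_scaleDr ore_scaleDl.

Fact ore_scaleAl (c : k) (p q : ore) : c *: (p * q) = (c *: p) * q.
Proof. exact/esym/ore_mulZl. Qed.

HB.instance Definition _ := GRing.LSemiModule_isLSemiAlgebra.Build k ore ore_scaleAl.

Fact ore_scaleAr (c : k) (p q : ore) : c *: (p * q) = p * (c *: q).
Proof.
have E n r : iter n ore_shift (df_in K c *: r) = df_in K c *: iter n ore_shift r.
  by elim: n => //= n ->; rewrite ore_shiftZ /delta df_const scale0r addr0.
rewrite -[LHS]/(df_in K c *: ore_mul p q) -[RHS]/(ore_mul p (df_in K c *: (q : {poly K}))).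
elim/ore_ind: (p : {poly K}) => [|u v hu hv|a n].
- by rewrite !ore_mul0l scaler0.
- by rewrite !ore_mulDl scalerDr hu hv.
by rewrite !ore_mulZl !ore_mulXn E !scalerA mulrC.
Qed.

HB.instance Definition _ := GRing.LSemiAlgebra_isSemiAlgebra.Build k ore ore_scaleAr.

End Ore.

(** * Polynomial rings over Frobenius-related Ore extensions *)

Section PthPower.
Context (R : nzRingType) (p : nat) (hp : p \in [pchar R]).

Lemma pchar_bin0 (x : R) i : (0 < i < p)%N -> x *+ 'C(p, i) = 0.
Proof.
move=> lt; have /dvdnP[q ->] := prime_dvd_bin (pcharf_prime hp) lt.
by rewrite mulnC mulrnA -[x *+ p]mulr_natr pcharf0 ?mulr0 ?mul0rn.
Qed.

(** The inner binomial coefficients are divisible by p. *)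
Lemma iter_leibniz_pchar (d T : {additive R -> R}) f g :
    (forall f g, T (f * g) = d f * g + f * T g) ->
  iter p T (f * g) = iter p d f * g + f * iter p T g.
Proof.
move=> dT; rewrite (iter_leibniz _ _ _ dT).
have := pcharf_prime hp; case: (p) pchar_bin0 => [|[|q]] // mid0 _.
rewrite big_ord_recr big_ord_recl /= binn !mulr1n subnn big1 ?addr0 1?addrC //.
by move=> i _; rewrite mid0 //= /bump /=; have := ltn_ord i; lia.
Qed.

(** Left multiplication by Y and the commutator [Y, -] satisfy the
    two-operator Leibniz formula, evaluated here on j c and 1. *)
Lemma commutator_expp (K : nzRingType) (j : {rmorphism K -> R}) (d : K -> K) (Y : R) :
    (forall c, Y * j c = j c * Y + j (d c)) ->
  forall c, Y ^+ p * j c = j c * Y ^+ p + j (iter p d c).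
Proof.
move=> hY c.
pose T f := Y * f; pose ad f := Y * f - f * Y.
have Tadd : zmod_morphism T by move=> f g; rewrite /T mulrBr.
have adadd : zmod_morphism ad.
  by move=> f g; rewrite /ad mulrBr mulrBl !opprB addrACA [RHS]addrACA [X in _ + X]addrC.
pose T' : {additive R -> R} := HB.pack T (GRing.isZmodMorphism.Build _ _ T Tadd).
pose ad' : {additive R -> R} := HB.pack ad (GRing.isZmodMorphism.Build _ _ ad adadd).
have iterT n g : iter n T' g = Y ^+ n * g.
  elim: n => [|n IH]; first by rewrite expr0 mul1r.
  by rewrite iterS IH exprS -mulrA.
have iterad n a : iter n ad' (j a) = j (iter n d a).
  by elim: n => //= n ->; rewrite /ad hY addrC addKr.
have adT f g : T' (f * g) = ad' f * g + f * T' g.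
  by rewrite /= /T /ad mulrBl !mulrA subrK.
have := iter_leibniz_pchar (j c) 1 adT.
by rewrite iterad !iterT !mulr1 addrC.
Qed.

End PthPower.

Section OreGenerators.
Context (k : fieldType) (K : diff_field k).

Definition ore_const (c : K) : ore K := c%:P.
Definition ore_var : ore K := 'X.

Lemma ore_const_mul c (q : ore K) : ore_const c * q = c *: (q : {poly K}).
Proof.
by rewrite -[LHS]/(ore_mul c%:P q) -alg_polyC ore_mulZl ore_mul1l.
Qed.

Fact ore_const_additive : zmod_morphism ore_const.
Proof. by move=> a b; rewrite /ore_const polyCB. Qed.
Fact ore_const_monoid : monoid_morphism ore_const.
Proof.
by split=> // a b; rewrite ore_const_mul /ore_const polyCM mul_polyC.
Qed.
HB.instance Definition _ := GRing.isZmodMorphism.Build _ _ ore_const ore_const_additive.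
HB.instance Definition _ := GRing.isMonoidMorphism.Build _ _ ore_const ore_const_monoid.

Lemma ore_var_mul (q : ore K) : ore_var * q = ore_shift q.
Proof. exact: (ore_mulXn 1). Qed.

Lemma ore_var_exp n : ore_var ^+ n = 'X^n :> {poly K}.
Proof.
elim: n => [|n IH]; first by rewrite !expr0.
by rewrite exprS ore_var_mul IH ore_shiftXn.
Qed.

Lemma ore_relation c : ore_var * ore_const c = ore_const c * ore_var + ore_const (df_der K c).
Proof.
rewrite ore_var_mul ore_const_mul /ore_shift /ore_const map_polyC; congr (_ + _).
by rewrite mulrC mul_polyC.
Qed.

Lemma ore_const_in a : ore_const (df_in K a) = a%:A.
Proof. by rewrite /ore_const -alg_polyC. Qed.

Lemma ore_generated (P : ore K -> Prop) : P 0 -> (forall p q, P p -> P q -> P (p + q)) ->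
  (forall a n, P (ore_const a * ore_var ^+ n)) -> forall p, P p.
Proof.
move=> P0 PD PX; apply: (ore_ind (K := K)) => // a n.
by have := PX a n; rewrite ore_const_mul ore_var_exp.
Qed.

Section Lift.
Context (S : algType k) (j : {rmorphism K -> S}) (Y : S).
Context (hY : forall c, Y * j c = j c * Y + j (df_der K c)).
Context (hj : forall a, j (df_in K a) = a%:A).

Let h (p : ore K) : S := (map_poly j (p : {poly K})).[Y].

Let hD p q : h (p + q) = h p + h q.
Proof. by rewrite /h rmorphD hornerD. Qed.

Let hZ a (p : {poly K}) : h (a *: p : {poly K}) = j a * h p.
Proof. by rewrite /h linearZ /= hornerZ. Qed.

Let hXn n : h ('X^n : {poly K}) = Y ^+ n.
Proof. by rewrite /h map_polyXn hornerXn. Qed.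

Let h_shift p : h (ore_shift p) = Y * h p.
Proof.
elim/ore_ind: p => [|p q hp hq|a n].
- by rewrite raddf0 /h rmorph0 horner0 mulr0.
- by rewrite raddfD /= hD hp hq -mulrDr -hD.
by rewrite ore_shiftZ hD !hZ ore_shiftXn !hXn exprS !mulrA hY mulrDl.
Qed.

(** Universal property of the Ore extension. *)
Lemma ore_lift : exists f : {lrmorphism ore K -> S},
  (forall c, f (ore_const c) = j c) /\ f ore_var = Y.
Proof.
have hlin : linear h.
  move=> c p q; rewrite hD; congr (_ + _).
  rewrite -[c *: p]/(df_in K c *: (p : {poly K}) : {poly K}) hZ hj.
  by rewrite mulr_algl.
have hmul : monoid_morphism h.
  split=> [|p q]; first by rewrite /h rmorph1 hornerC.
  elim/ore_generated: p => [|p p' hp hp'|a n].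
  - by rewrite mul0r /h rmorph0 horner0 mul0r.
  - by rewrite mulrDl !hD hp hp' mulrDl.
  have hV : h (ore_var ^+ n) = Y ^+ n by rewrite ore_var_exp hXn.
  rewrite -mulrA !ore_const_mul !hZ hV -mulrA; congr (_ * _).
  elim: n {hV} => [|n IH]; first by rewrite !expr0 !mul1r.
  by rewrite !exprS -!mulrA ore_var_mul h_shift IH.
pose f : {lrmorphism ore K -> S} := HB.pack h
  (GRing.isLinear.Build _ _ _ _ h hlin) (GRing.isMonoidMorphism.Build _ _ h hmul).
exists f; split=> [c|] /=; first by rewrite /h map_polyC hornerC.
by rewrite /h map_polyX hornerX.
Qed.

End Lift.
End OreGenerators.

Lemma poly_alg_lift (k : fieldType) (A S : algType k) (h : {lrmorphism A -> S}) (s : S) :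
    (forall a, s * h a = h a * s) ->
  exists f : {lrmorphism poly_alg A -> S},
    (forall a, f (constp a) = h a) /\ f ('X : {poly A}) = s.
Proof.
move=> hs; pose g (p : poly_alg A) : S := horner_morph hs p.
have glin : linear g.
  move=> c p q; rewrite /g rmorphD; congr (_ + _).
  rewrite -[c *: p]/(c%:A%:P * (p : {poly A})) rmorphM /= horner_morphC.
  by rewrite /= linearZ /= rmorph1 mulr_algl.
have gmul : monoid_morphism g by split=> [|p q]; rewrite /g ?rmorph1 ?rmorphM.
pose f : {lrmorphism poly_alg A -> S} := HB.pack g
  (GRing.isLinear.Build _ _ _ _ g glin) (GRing.isMonoidMorphism.Build _ _ g gmul).
by exists f; split=> [a|]; rewrite /= /g ?horner_morphC ?horner_morphX.
Qed.

Lemma poly_ore_ext (k : fieldType) (K : diff_field k) (S : algType k)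
    (f g : {lrmorphism poly_alg (ore K) -> S}) :
    (forall c, f (constp (ore_const c)) = g (constp (ore_const c))) ->
    f (constp (ore_var K)) = g (constp (ore_var K)) ->
    f ('X : {poly ore K}) = g ('X : {poly ore K}) ->
  f =1 g.
Proof.
move=> hc hv hX.
have hA a : f (constp a) = g (constp a).
  elim/ore_generated: a => [|p q hp hq|a n]; first by rewrite !raddf0.
    by rewrite !rmorphD /= hp hq.
  by rewrite !rmorphM !rmorphXn /= hc hv.
elim/poly_ind => [|p a IH]; first by rewrite !raddf0.
have -> : (p * 'X + a%:P : {poly _}) =
  (p : poly_alg (ore K)) * ('X : {poly _}) + constp a by [].
by rewrite [LHS]rmorphD [RHS]rmorphD rmorphM [in RHS]rmorphM /= IH hA hX.
Qed.

Lemma poly_ore_lift (k : fieldType) (K : diff_field k) (S : algType k)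
    (j : {rmorphism K -> S}) (Y s : S) :
    (forall c, Y * j c = j c * Y + j (df_der K c)) ->
    (forall a, j (df_in K a) = a%:A) ->
    (forall c, s * j c = j c * s) -> s * Y = Y * s ->
  exists f : {lrmorphism poly_alg (ore K) -> S},
    [/\ forall c, f (constp (ore_const c)) = j c, f (constp (ore_var K)) = Y
      & f ('X : {poly ore K}) = s].
Proof.
move=> hY hj sj sY; have [h [hc hv]] := ore_lift hY hj.
have [|f [fC fX]] := @poly_alg_lift _ _ _ h s.
  elim/ore_generated => [|p q hp hq|a n]; first by rewrite !raddf0 mulr0 mul0r.
    by rewrite !rmorphD mulrDr mulrDl hp hq.
  rewrite !rmorphM !rmorphXn /= hc hv mulrA sj -!mulrA; congr (_ * _).
  by apply: commrX.
by exists f; split=> [c||]; rewrite ?fC ?hc.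
Qed.

Section Twins.
Context (k F : fieldType) (iota : {rmorphism k -> F}) (p : nat) (hp : p \in [pchar k]).
Context (d d' : {additive F -> F}) (dL : leibniz d) (dL' : leibniz d').
Context (dC : forall c, d (iota c) = 0) (dC' : forall c, d' (iota c) = 0).
Context (dp : forall c, iter p d c = d' c) (dp' : forall c, iter p d' c = d c).

Let K := DiffField dL dC.
Let K' := DiffField dL' dC'.

(** With Y = x^p + t and X = y^p - s the maps are given by y |-> Y, s |-> Y^p
    - x and x |-> X, t |-> y - X^p. The elements Y^p - x and y - X^p are
    central because delta'^p = delta and delta^p = delta'. *)
Lemma poly_ore_iso : alg_iso (poly_alg (ore K)) (poly_alg (ore K')).
Proof.
pose S : algType k := poly_alg (ore K); pose S' : algType k := poly_alg (ore K').
have hpS : p \in [pchar S] by rewrite pchar_lalg.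
have hpS' : p \in [pchar S'] by rewrite pchar_lalg.
pose j : {rmorphism K -> S} := @constp k (ore K) \o @ore_const k K.
pose j' : {rmorphism K' -> S'} := @constp k (ore K') \o @ore_const k K'.
pose x : S := constp (ore_var K); pose y : S' := constp (ore_var K').
pose t : S := ('X : {poly ore K}); pose s : S' := ('X : {poly ore K'}).
have jin a : j (df_in K a) = a%:A.
  by rewrite /j /= ore_const_in linearZ rmorph1.
have jin' a : j' (df_in K' a) = a%:A.
  by rewrite /j' /= ore_const_in linearZ rmorph1.
have tC u : t * u = u * t by exact/esym/commr_polyX.
have sC u : s * u = u * s by exact/esym/commr_polyX.
have xj c : x * j c = j c * x + j (d c).
  by rewrite /x /j /= -!rmorphM -rmorphD -(ore_relation (K := K)).
have yj c : y * j' c = j' c * y + j' (d' c).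
  by rewrite /y /j' /= -!rmorphM -rmorphD -(ore_relation (K := K')).
pose Y := x ^+ p + t; pose X := y ^+ p - s.
have Yj c : Y * j c = j c * Y + j (d' c).
  by rewrite /Y mulrDl mulrDr (commutator_expp hpS xj) dp tC addrAC.
have Xj c : X * j' c = j' c * X + j' (d c).
  by rewrite /X mulrBl mulrBr (commutator_expp hpS' yj) dp' sC addrAC.
have xY : GRing.comm x Y by apply: commrD; [exact: commrX|exact/esym/tC].
have yX : GRing.comm y X by apply: commrB; [exact: commrX|exact/esym/sC].
have sj c : (Y ^+ p - x) * j c = j c * (Y ^+ p - x).
  rewrite mulrBl mulrBr (commutator_expp hpS Yj) xj dp' opprD addrACA -addrA.
  by rewrite subrr addr0.
have tj c : (y - X ^+ p) * j' c = j' c * (y - X ^+ p).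
  rewrite mulrBl mulrBr (commutator_expp hpS' Xj) yj dp opprD addrACA.
  by rewrite subrr addr0.
have sY : (Y ^+ p - x) * Y = Y * (Y ^+ p - x).
  by apply/esym/commrB; [exact: commrX|exact/commr_sym].
have tX : (y - X ^+ p) * X = X * (y - X ^+ p).
  by apply/esym/commrB; [exact/commr_sym|exact: commrX].
have [f [fc fv fX]] := @poly_ore_lift k K S' j' X _ Xj jin' tj tX.
have [g [gc gv gX]] := @poly_ore_lift k K' S j Y _ Yj jin sj sY.
exists f; exists g.
  apply: (@poly_ore_ext k K S (g \o f) idfun) => [c||] /=.
  - by rewrite fc gc.
  - by rewrite fv /X rmorphB rmorphXn /= gv gX subKr.
  - by rewrite fX rmorphB rmorphXn /= gv /X rmorphB rmorphXn /= gv gX subKr addrC addKr.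
apply: (@poly_ore_ext k K' S' (f \o g) idfun) => [c||] /=.
- by rewrite gc fc.
- by rewrite gv /Y rmorphD rmorphXn /= fv fX addrC subrK.
- by rewrite gX rmorphB rmorphXn /= fv /Y rmorphD rmorphXn /= fv fX (addrC (X ^+ p)) subrK subKr.
Qed.
End Twins.

(** * Degrees in an Ore extension *)

Section OreDegree.
Context (k : fieldType) (K : diff_field k).

Lemma iter_ore_shift_top m n (q : {poly K}) : (size q <= m.+1)%N ->
  (size (iter n (@ore_shift k K) q) <= (n + m).+1)%N /\
  (iter n (@ore_shift k K) q)`_(n + m) = q`_m.
Proof.
move=> hq; elim: n => [|n [IH1 IH2]] //.
have sm : (size (map_poly (df_der K) (iter n (@ore_shift k K) q)) <= (n + m).+1)%N.
  exact: leq_trans (size_poly _ _) IH1.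
rewrite iterS /ore_shift; split.
  apply: leq_trans (size_polyD _ _) _; rewrite geq_max; apply/andP; split.
    apply: leq_trans (size_polyMleq _ _) _.
    by rewrite size_polyX add2n /= addSn ltnS; exact: IH1.
  exact: leqW.
by rewrite coefD coefXM addSn /= IH2 [X in _ + X]nth_default ?addr0.
Qed.

(** Left multiplication by x preserves leading coefficients, so degrees behave
    as for commutative polynomials. *)
Lemma ore_mul_top a b (p q : ore K) :
    (size (p : {poly K}) <= a.+1)%N -> (size (q : {poly K}) <= b.+1)%N ->
  (size ((p * q)%R : {poly K}) <= (a + b).+1)%N /\
  (p * q : {poly K})`_(a + b) = (p : {poly K})`_a * (q : {poly K})`_b.
Proof.
move=> hp hq; rewrite -[p * q]/(ore_mul p q) (ore_mulE _ hp); split.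
  apply/leq_sizeP => j hj; rewrite coef_sum big1 // => i _; rewrite coefZ.
  have [si _] := iter_ore_shift_top i hq; rewrite [X in _ * X]nth_default ?mulr0 //.
  by apply: leq_trans si _; have := ltn_ord i; lia.
rewrite big_ord_recr coefD coef_sum big1 ?add0r => [|i _].
  by rewrite coefZ (iter_ore_shift_top a hq).2.
rewrite coefZ; have [si _] := iter_ore_shift_top i hq; rewrite [X in _ * X]nth_default ?mulr0 //.
by apply: leq_trans si _; rewrite /= -addSn leq_add2r.
Qed.

Lemma ore_mul_lead (p q : ore K) : p <> 0 -> q <> 0 ->
  (p * q : {poly K})`_((size (p : {poly K})).-1 + (size (q : {poly K})).-1) <> 0.
Proof.
move=> /eqP p0 /eqP q0; rewrite (ore_mul_top _ _).2 ?leqSpred //.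
by apply/eqP; rewrite mulf_neq0 // -/(lead_coef _) lead_coef_eq0.
Qed.

Lemma ore_domain : is_domain (ore K).
Proof.
move=> p q pq; apply: contrapT => /not_orP[p0 q0].
by apply: (ore_mul_lead p0 q0); rewrite pq coef0.
Qed.

(** Degrees are additive. *)
Lemma ore_unit (u v : ore K) : u * v = 1 -> exists c, u = ore_const c.
Proof.
move=> uv.
have u0 : u <> 0 by move=> u0; have /eqP := uv; rewrite u0 mul0r eq_sym oner_eq0.
have v0 : v <> 0 by move=> v0; have /eqP := uv; rewrite v0 mulr0 eq_sym oner_eq0.
exists (u : {poly K})`_0; apply: size1_polyC.
have := ore_mul_lead u0 v0; rewrite uv coef1.
by case: (size (u : {poly K})) => [|[|n]].
Qed.

Lemma ore_expansion (q : ore K) n : (size (q : {poly K}) <= n)%N ->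
  q = \sum_(i < n) ore_const (q : {poly K})`_i * ore_var K ^+ i.
Proof.
move=> le; under eq_bigr => i _ do rewrite ore_const_mul ore_var_exp.
rewrite -[LHS](coefK (q : {poly K})) poly_def.
rewrite (big_ord_widen n (fun i => (q : {poly K})`_i *: 'X^i)) // big_mkcond.
by apply: eq_bigr => i _; case: ltnP => // ge; rewrite nth_default ?scale0r.
Qed.

Lemma ore_exp_top (X : ore K) m i : (size (X : {poly K}) <= m.+1)%N ->
  (size ((X ^+ i)%R : {poly K}) <= (m * i).+1)%N /\
  (X ^+ i : {poly K})`_(m * i) = (X : {poly K})`_m ^+ i.
Proof.
move=> hX; elim: i => [|i [IH1 IH2]].
  by rewrite muln0 !expr0 coef1 size_poly1.
rewrite exprS mulnS; have [h1 h2] := ore_mul_top hX IH1.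
by split=> //; rewrite h2 IH2 -exprS.
Qed.

Context (n : nat) (e : 'I_n -> K).
Context (span_e : forall z : K, exists c : 'I_n -> k, z = \sum_i df_in K (c i) * e i).

Lemma ore_const_span z : exists c : 'I_n -> k,
  ore_const z = \sum_i c i *: ore_const (e i).
Proof.
have [c zc] := span_e z; exists c; rewrite zc rmorph_sum.
by apply: eq_bigr => i _; rewrite rmorphM /= ore_const_in mulr_algl.
Qed.

Lemma ore_affine : affine (ore K).
Proof.
apply/affineP; exists (ore_var K :: [seq ore_const (e i) | i <- enum 'I_n]).
move=> P P1 Pl PM Ps.
have P0 : P 0 by rewrite -(addNr 1) -scaleN1r; exact: Pl.
have PD u v : P u -> P v -> P (u + v) by rewrite -{2}(scale1r u); exact: Pl.
apply: ore_generated => // a i; apply: (PM).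
  have [c ->] := ore_const_span a; apply: big_ind => // j _.
  rewrite -[_ *: _]addr0; apply: Pl => //; apply: Ps.
  by rewrite inE; apply/orP; right; apply/mapP; exists j; rewrite ?mem_enum.
elim: i => [|i IH]; rewrite ?expr0 // exprS; apply: PM => //.
by apply: Ps; rewrite inE eqxx.
Qed.

Local Open Scope classical_set_scope.

Lemma ore_ldim_leq (W : set (ore K)) m :
  (forall q, W q -> (size (q : {poly K}) <= m)%N) -> (ldim W <= n * m)%N.
Proof.
move=> hW.
pose w (l : 'I_#|{: 'I_n * 'I_m}|) : ore K :=
  ore_const (e (enum_val l).1) * ore_var K ^+ (enum_val l).2.
suff : (ldim W <= #|{: 'I_n * 'I_m}|)%N by rewrite card_prod !card_ord.
apply: (@ldim_leq _ _ _ _ w) => q /hW/ore_expansion ->.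
apply: lin_subspace_sum => [|j _]; first exact: lspan_subspace.
have [c ->] := ore_const_span (q : {poly K})`_j; rewrite mulr_suml.
apply: lin_subspace_sum => [|i _]; first exact: lspan_subspace.
rewrite -scalerAl; apply: (lin_subspaceZ _ (lspan_subspace (range w))).
by apply: lspan_sub; exists (enum_rank (i, j)) => //; rewrite /w enum_rankK.
Qed.

Definition ore_size_le m (q : ore K) : Prop := (size (q : {poly K}) <= m)%N.

Lemma ore_size_le_subspace m : lin_subspace (ore_size_le m).
Proof.
apply: conj; first by rewrite /ore_size_le size_poly0.
rewrite /ore_size_le => a u v hu hv.
apply: leq_trans (size_polyD _ _) _; rewrite geq_max hv andbT.
exact: leq_trans (size_scale_leq _ _) hu.
Qed.

Lemma ore_filt_size (V : set (ore K)) D N :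
  V `<=` ore_size_le D.+1 -> filt V N `<=` ore_size_le (D * N).+1.
Proof.
move=> hV.
have expV i : set_exp V i `<=` ore_size_le (D * i).+1.
  elim: i => [|i IH] /=; apply: lspan_min; try exact: ore_size_le_subspace.
    by move=> _ ->; rewrite /ore_size_le size_poly1.
  move=> _ [u [v [/hV hu /IH hv ->]]].
  by rewrite mulnS; exact: (ore_mul_top hu hv).1.
apply: lspan_min; first exact: ore_size_le_subspace.
move=> x [i lti /expV hx]; apply: leq_trans hx _.
by rewrite ltnS leq_mul2l -ltnS lti orbT.
Qed.

End OreDegree.

(** * Growth of an Ore extension *)

Section Growth.
Context (R : realType).

(** ln (C N) / ln N tends to 1. *)
Lemma limn_esup_ln_linear (f : nat -> nat) C :
    (forall N, (0 < N)%N -> (f N <= C * N)%N) ->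
  (limn_esup (fun N => (ln (f N)%:R / ln N%:R : R)%:E) <= 1)%E.
Proof.
move=> fC; apply/lee_addgt0Pr => eps eps0.
(* Beyond M one has ln (C + 1) <= eps ln N. *)
pose M := (Num.truncn (expR (ln C.+1%:R / eps))).+1.
pose A := [set N : nat | (maxn 2 M <= N)%N]%classic.
have lnC : 0 <= ln C.+1%:R :> R by apply: ln_ge0; rewrite ler1n.
apply: (@le_trans _ _ (ereal_sup [set (ln (f N)%:R / ln N%:R : R)%:E | N in A]%classic)).
  by apply: ereal_inf_lbound; exists A => //; exists (maxn 2 M).
apply: ge_ereal_sup => _ [N AN <-].
move: AN; rewrite /A /= geq_max => /andP[N2 MN].
have N0 : (0 < N)%N by apply: leq_trans N2.
have lN : 0 < ln N%:R :> R by apply: ln_gt0; rewrite ltr1n.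
rewrite lee_fin ler_pdivrMr // mulrDl mul1r.
have lnCN : ln C.+1%:R <= eps * ln N%:R :> R.
  rewrite -ler_pdivrMl // mulrC -[leLHS]expRK ler_ln ?posrE ?expR_gt0 ?ltr0n //.
  apply/ltW/(lt_le_trans (truncnS_gt _)); by rewrite ler_nat.
apply: (@le_trans _ _ (ln (C.+1 * N)%:R)); last first.
  by rewrite natrM lnM ?posrE ?ltr0n // addrC lerD2l.
have [f0|f0] := posnP (f N).
  by rewrite f0 ln0 // ln_ge0 // ler1n muln_gt0.
rewrite ler_ln ?posrE ?ltr0n ?muln_gt0 // ler_nat.
by apply: leq_trans (fC N N0) _; rewrite leq_mul2r leqnSn orbT.
Qed.

Lemma limn_esup_ln_ge1 (f : nat -> nat) : (forall N, (N <= f N)%N) ->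
  (1 <= limn_esup (fun N => (ln (f N)%:R / ln N%:R : R)%:E))%E.
Proof.
move=> fN; apply: le_ereal_inf_tmp => _ [A [M _ MA] <-].
pose N := maxn 2 M; apply: (@le_trans _ _ (ln (f N)%:R / ln N%:R : R)%:E); last first.
  by apply: ereal_sup_ubound; exists N => //; apply: MA; rewrite /= leq_maxr.
have N2 : (1 < N)%N by rewrite leq_maxl.
have lN : 0 < ln N%:R :> R by apply: ln_gt0; rewrite ltr1n.
have N0 : (0 < N)%N by exact: ltnW.
have f0 : (0 < f N)%N by exact: leq_trans (fN N).
by rewrite lee_fin ler_pdivlMr // mul1r ler_ln ?posrE ?ltr0n ?ler_nat.
Qed.

(** The filtration step N has dimension at most n (D N + 1) when the
    generators have degree at most D, and at least N if x is among the
    generators. *)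
Lemma ore_GKdim (k : fieldType) (K : diff_field k) n (e : 'I_n -> K) :
    (forall z : K, exists c : 'I_n -> k, z = \sum_i df_in K (c i) * e i) ->
  GKdim (ore K) R = 1%E.
Proof.
move=> span_e; apply/eqP; rewrite eq_le; apply/andP; split.
  apply: ge_ereal_sup => _ [V [s Vs] <-].
  pose D := (\max_(q <- s) size (q : {poly K}))%N.
  have VD : (V `<=` @ore_size_le _ K D.+1)%classic.
    rewrite -Vs; apply: lspan_min; first exact: ore_size_le_subspace.
    by move=> q qs; apply: leqW; apply: (@leq_bigmax_seq _ _ xpredT _ q).
  apply: (@limn_esup_ln_linear _ (n * D.+1)) => N N0.
  apply: leq_trans (ore_ldim_leq span_e (ore_filt_size (N := N) VD)) _.
  by rewrite -mulnA leq_mul2l mulSn -[(D * N).+1]add1n leq_add2r N0 orbT.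
pose V : set (ore K) := lspan [set` [:: ore_var K]]%classic.
have Vfin : fin_dim V by exists [:: ore_var K].
apply: (@le_trans _ _
    (limn_esup (fun N => (ln (ldim (filt V N))%:R / ln N%:R : R)%:E))); last first.
  by apply: ereal_sup_ubound; exists V.
apply: limn_esup_ln_ge1 => N; have [m [w hw]] := filt_span N Vfin.
apply: (ldim_geq (v := fun i : 'I_N => ore_var K ^+ i) _ hw) => [|c c0 i|i].
- exact: lspan_subspace.
- have /polyP/(_ i) := c0; rewrite coef0 => ci.
  apply: (fmorph_inj (df_in K)); rewrite rmorph0 -[RHS]ci coef_sum.
  rewrite (bigD1 i) //= big1 ?addr0 => [|j ji].
    by rewrite -[_ *: _]/(df_in K (c i) *: (ore_var K ^+ i : {poly K})) coefZ
      ore_var_exp coefXn eqxx mulr1.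
  rewrite -[_ *: _]/(df_in K (c j) *: (ore_var K ^+ j : {poly K})) coefZ.
  rewrite ore_var_exp coefXn; case: eqP => [ij|]; last by rewrite mulr0.
  by move: ji; rewrite -val_eqE /= ij eqxx.
apply: (@filt_exp _ _ _ _ i); first exact: ltnW.
have xV : V (ore_var K) by apply: lspan_sub; rewrite /= inE.
by have := @set_exp_pow _ _ V i 0 _ _ xV xV; rewrite addn0 expr0 mulr1.
Qed.

End Growth.

(** * Non-isomorphic Ore extensions *)

(** Degrees are multiplied by the degree of the image of the variable. *)
Lemma ore_morphism_top (k : fieldType) (K K' : diff_field k) (f : {lrmorphism ore K -> ore K'})
    (sigma : K -> K') m b (q : ore K) :
    (forall c, f (ore_const c) = ore_const (sigma c)) ->
    (size (f (ore_var K) : {poly K'}) <= m.+1)%N -> (0 < m)%N ->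
    (size (q : {poly K}) <= b.+1)%N ->
  (f q : {poly K'})`_(m * b) =
    sigma (q : {poly K})`_b * (f (ore_var K) : {poly K'})`_m ^+ b.
Proof.
move=> hc hX m0 hq; rewrite {1}(ore_expansion hq) rmorph_sum coef_sum.
rewrite big_ord_recr big1 /= ?add0r => [|i _];
  rewrite rmorphM rmorphXn /= hc ore_const_mul coefZ.
  by rewrite (ore_exp_top b hX).2.
rewrite [X in _ * X]nth_default ?mulr0 //.
by apply: leq_trans (ore_exp_top i hX).1 _; rewrite ltn_pmul2l.
Qed.

Section NonIso.
Context (k F : fieldType) (iota : {rmorphism k -> F}) (p : nat) (hp : p \in [pchar F]).
Context (d d' : {additive F -> F}) (dL : leibniz d) (dL' : leibniz d').
Context (dC : forall c, d (iota c) = 0) (dC' : forall c, d' (iota c) = 0).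
Context (insep : forall z : F, exists c, z ^+ p = iota c).
Context (nprop : forall c, ~ (forall z, d z = c * d' z)).

Let K := DiffField dL dC.
Let K' := DiffField dL' dC'.

(** Units go to units, so f maps K to K', and it fixes K since it fixes p-th
    powers. The image X of the variable has degree m, and all images have
    degree divisible by m; surjectivity forces m = 1. Then [X, c] = delta(c)
    compares delta with delta'. *)
Lemma ore_not_iso : ~ alg_iso (ore K) (ore K').
Proof.
case=> f /lrmorphism_inverse[g [fK gK]].
have fc (c : K) : f (ore_const c) = ore_const (c : K').
  have [->|c0] := pselect (c = 0); first by rewrite !rmorph0.
  have [s fs] : exists s, f (ore_const c) = ore_const (s : K').
    apply: (ore_unit (v := f (ore_const (c^-1 : K)))).
    by rewrite -!rmorphM mulfV ?rmorph1 //; apply/eqP.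
  rewrite fs; congr ore_const; have [a ca] := insep c.
  have : f (ore_const (c ^+ p)) = ore_const (c ^+ p : K').
    rewrite ca (@ore_const_in k K) (@ore_const_in k K').
    by rewrite linearZ rmorph1.
  rewrite !rmorphXn /= fs -!rmorphXn => /polyC_inj sc.
  apply: (fmorph_inj (pFrobenius_aut hp)).
  by rewrite /= !pFrobenius_autE.
set X := f (ore_var K).
have relX (a : K) : X * ore_const (a : K') = ore_const (a : K') * X + ore_const (d a : K').
  by rewrite -!fc -!rmorphM -rmorphD -(ore_relation (K := K)).
pose m := (size (X : {poly F})).-1.
have sX : (size (X : {poly F}) <= m.+1)%N by exact: leqSpred.
have gX : f (g (ore_var K')) = ore_var K' by rewrite gK.
have m0 : (0 < m)%N.
  rewrite lt0n; apply/eqP => m0; rewrite m0 in sX.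
  have [s Xs] : exists s, X = ore_const (s : K').
    by exists (X : {poly F})`_0; exact: size1_polyC.
  have := relX; rewrite Xs => relX'.
  have d0 a : d a = 0.
    have := relX' a; rewrite -!rmorphM mulrC => /eqP.
    rewrite -subr_eq0 opprD addrA subrr sub0r oppr_eq0 => /eqP.
    exact: polyC_inj.
  by case: (nprop (c := 0)) => z; rewrite d0 mul0r.
have m1 : m = 1%N.
  pose q : {poly F} := g (ore_var K').
  pose b := (size q).-1.
  have sq : (size q <= b.+1)%N by exact: leqSpred.
  have q0 : q != 0.
    apply/eqP => q0; have := gX; rewrite -/q q0 rmorph0 => /esym/eqP.
    by rewrite polyX_eq0.
  have := @ore_morphism_top k K K' f id m b q fc sX m0 sq.
  rewrite [f _]gX coefX => mb.
  have {}mb : (m * b == 1)%N.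
    case: eqP mb => // _ /esym/eqP; rewrite mulf_eq0 expf_eq0.
    rewrite -/(lead_coef q) lead_coef_eq0 (negPf q0) /= -/(lead_coef (X : {poly F})).
    rewrite lead_coef_eq0 => /andP[_ /eqP X0].
    by move: m0; rewrite /m X0 size_poly0.
  by move: mb; rewrite muln_eq1 => /andP[/eqP].
have XE : X = ore_const ((X : {poly F})`_0 : K') + ore_const ((X : {poly F})`_1 : K') * ore_var K'.
  have := @ore_expansion k K' X 2; rewrite -{1}m1 => /(_ sX) {1}->.
  by rewrite 2!big_ord_recr big_ord0 /= add0r expr0 mulr1 expr1.
move: XE; set c0 : K' := (X : {poly F})`_0; set c1 : K' := (X : {poly F})`_1 => XE.
have cc (u v : K') : ore_const u * ore_const v = ore_const v * ore_const u.
  by rewrite -!rmorphM mulrC.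
case: (nprop (c := c1)) => a; apply: polyC_inj.
rewrite -[LHS]/(ore_const (d a : K')) -[RHS]/(ore_const (c1 * df_der K' a)).
have := relX a; rewrite XE mulrDl mulrDr -mulrA (@ore_relation k K') mulrDr.
rewrite (cc c0) (mulrA (ore_const c1) _ (ore_var K')) (cc c1) -mulrA addrA.
by move/addrI => <-; rewrite rmorphM.
Qed.
End NonIso.

(** * Derivations of a field of fractions *)

Section QuotientRule.
Context (F : fieldType).

(** The quotient rule does not depend on the fraction n / m chosen for x; the
    hypothesis is the derivative of the equality of two cross products. *)
Lemma quotient_rule_cross (x dn dn0 m m0 dm dm0 : F) : m != 0 -> m0 != 0 ->
    dn * m0 + x * m * dm0 = dn0 * m + x * m0 * dm ->
  (dn0 - x * dm0) / m0 = (dn - x * dm) / m.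
Proof.
move=> hm hm0 h; apply/eqP; rewrite eqr_div //; apply/eqP.
have -> : (dn0 - x * dm0) * m = (dn0 * m + x * m0 * dm) - x * m0 * dm - x * m * dm0.
  by ring.
by rewrite -h; ring.
Qed.

Lemma quotient_rule_sub (x y dn dn' m dm : F) :
  (dn - dn' - (x - y) * dm) / m = (dn - x * dm) / m - (dn' - y * dm) / m.
Proof. by ring. Qed.

Lemma quotient_rule_mul (x y dn dn' m dm : F) : m != 0 ->
  (dn * (y * m) + x * m * dn' - x * y * (dm * m + m * dm)) / (m * m) =
  (dn - x * dm) / m * y + x * ((dn' - y * dm) / m).
Proof. by move=> m0; field. Qed.

Lemma common_denominator (n m n' m' : F) : m != 0 -> m' != 0 ->
  n / m = n * m' / (m * m') /\ n' / m' = n' * m / (m * m').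
Proof. by move=> hm hm'; split; field; rewrite hm hm'. Qed.

Lemma mulf_quotients (n n' m : F) : m != 0 -> n / m * (n' / m) = n * n' / (m * m).
Proof. by move=> m0; field. Qed.

End QuotientRule.

Section FractionDerivation.
Context (P : idomainType) (D : {additive P -> P}) (DL : leibniz D).
Local Notation "x %:F" := (@FracField.tofrac P x).

Lemma fraction_numden (x : {fraction P}) :
  exists nm : P * P, nm.2%:F != 0 /\ x = nm.1%:F / nm.2%:F.
Proof.
have [r ->] : exists r : {ratio P}, x = \pi_({fraction P})%qT r.
  by exists (repr x); rewrite reprK.
have d0 : (frac r).2%:F != 0 by rewrite tofrac_eq0 denom_ratioP.
exists (frac r); split => //=; apply: (mulIf d0); rewrite mulfVK // !piE.
apply/eqmodP; rewrite /= FracField.equivfE.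
rewrite /FracField.mulf !numden_Ratio ?oner_neq0 ?mulf_neq0 ?oner_neq0 ?denom_ratioP //.
by rewrite !mulr1 mulrC.
Qed.

(** The quotient rule (D n - x D m) / m for x = n / m, computed on chosen
    representatives. Additivity and the Leibniz rule are checked on a common
    denominator. *)
Lemma fraction_derivation :
  exists2 D' : {additive {fraction P} -> {fraction P}},
    leibniz D' & forall a, D' a%:F = (D a)%:F.
Proof.
have /choice[f hf] := fraction_numden.
pose D0 x := ((D (f x).1)%:F - x * (D (f x).2)%:F) / (f x).2%:F.
have D0E x n m : m%:F != 0 -> x = n%:F / m%:F ->
    D0 x = ((D n)%:F - x * (D m)%:F) / m%:F.
  move=> m0 xE; rewrite /D0; have [] := hf x; case: (f x) => n0 m0' /= m0'0 xE0.
  have nE : n%:F = x * m%:F by rewrite xE mulfVK.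
  have n0E : n0%:F = x * m0'%:F by rewrite xE0 mulfVK.
  have cross : n * m0' = n0 * m.
    by apply/eqP; rewrite -tofrac_eq !tofracM nE n0E mulrAC.
  have := congr1 (fun a => (D a)%:F) cross.
  rewrite /= !DL !tofracD !tofracM nE n0E => E.
  exact: quotient_rule_cross.
have common x y : exists n n' m, [/\ m%:F != 0, x = n%:F / m%:F & y = n'%:F / m%:F].
  have [] := hf x; case: (f x) => n m /= m0 ->.
  have [] := hf y; case: (f y) => n' m' /= m'0 ->.
  exists (n * m'), (n' * m), (m * m').
  by rewrite !tofracM mulf_neq0 //; have [<- <-] := common_denominator n%:F n'%:F m0 m'0.
have D0add : zmod_morphism D0.
  move=> x y; have [n [n' [m [m0 xE yE]]]] := common x y.
  rewrite (D0E x n m) // (D0E y n' m) // (D0E (x - y) (n - n') m) //.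
    by rewrite raddfB tofracB quotient_rule_sub.
  by rewrite xE yE tofracB mulrBl.
pose D' : {additive {fraction P} -> {fraction P}} :=
  HB.pack D0 (GRing.isZmodMorphism.Build _ _ D0 D0add).
exists D' => [x y|a] /=.
  have [n [n' [m [m0 xE yE]]]] := common x y.
  rewrite (D0E x n m) // (D0E y n' m) // (D0E (x * y) (n * n') (m * m)).
  - have nE : n%:F = x * m%:F by rewrite xE mulfVK.
    have n'E : n'%:F = y * m%:F by rewrite yE mulfVK.
    by rewrite !DL !tofracD !tofracM nE n'E quotient_rule_mul.
  - by rewrite tofracM mulf_neq0.
  - by rewrite xE yE !tofracM mulf_quotients.
rewrite (D0E _ a 1) ?tofrac1 ?oner_neq0 ?divr1 //.
by rewrite (leibniz1 DL) tofrac0 mulr0 subr0.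
Qed.
End FractionDerivation.

(** * A non-cancellative algebra in characteristic p *)

Section FieldDerivations.
Context (F : fieldType).

Lemma leibniz_inv (d : {additive F -> F}) x : leibniz d -> x != 0 ->
  d x^-1 = - (x^-1 * d x * x^-1).
Proof.
move=> dL x0; have := dL x^-1 x; rewrite mulVf // leibniz1 // => /eqP.
rewrite eq_sym addr_eq0 => /eqP h; apply: (mulIf x0).
by rewrite h mulNr mulfVK.
Qed.

Lemma leibniz_exp (d : {additive F -> F}) x n : leibniz d ->
  d (x ^+ n) = (x ^+ n.-1 * d x) *+ n.
Proof.
move=> dL; elim: n => [|[|n] IH]; first by rewrite expr0 leibniz1 // mulr0n.
  by rewrite expr1 expr0 mul1r.
by rewrite exprS dL IH [RHS]mulrSr addrC mulrnAr mulrA -exprS [d x * _]mulrC.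
Qed.

Lemma iter_derivation p (d : {additive F -> F}) : p \in [pchar F] -> leibniz d ->
  exists2 d' : {additive F -> F}, leibniz d' & forall z, d' z = iter p d z.
Proof.
move=> hp dL.
have dadd : zmod_morphism (iter p d).
  move=> x y; rewrite iter_raddfD; congr (_ + _); elim: (p) => //= n ->.
  by rewrite raddfN.
pose d' : {additive F -> F} := HB.pack (iter p d)
  (GRing.isZmodMorphism.Build _ _ (iter p d) dadd).
by exists d' => // f g; exact: iter_leibniz_pchar.
Qed.

End FieldDerivations.

Section FunctionField.
Context (E : fieldType).

Notation Q := {fraction {poly {poly E}}}.
Notation inQ := (@FracField.tofrac {poly {poly E}}).

Definition scalar2 (c : E) : Q := inQ c%:P%:P.
Definition var_u : Q := inQ 'X%:P.
Definition var_v : Q := inQ 'X.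

Lemma function_field_ind (S : Q -> Prop) :
    (forall c, S (scalar2 c)) -> S var_u -> S var_v ->
    (forall x y, S x -> S y -> S (x + y)) -> (forall x y, S x -> S y -> S (x * y)) ->
    (forall x, x != 0 -> S x -> S x^-1) ->
  forall z, S z.
Proof.
move=> Sc Su Sv SD SM SV z.
have S0 : S 0 by have := Sc 0; rewrite /scalar2 !polyC0 tofrac0.
have SP (f : {poly {poly E}}) : S (inQ f).
  elim/poly_ind: f => [|f g IH]; first by rewrite tofrac0.
  rewrite tofracD tofracM; apply: (SD); first exact: SM.
  elim/poly_ind: g => [|g c IHg]; first by rewrite polyC0 tofrac0.
  by rewrite polyCD polyCM tofracD tofracM; apply: (SD); [exact: SM|exact: Sc].
by have [[n m] /= [m0 ->]] := fraction_numden z; apply: (SM) => //; exact: SV.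
Qed.

Lemma derivation_ext (d1 d2 : {additive Q -> Q}) : leibniz d1 -> leibniz d2 ->
    (forall c, d1 (scalar2 c) = d2 (scalar2 c)) -> d1 var_u = d2 var_u ->
    d1 var_v = d2 var_v ->
  forall z, d1 z = d2 z.
Proof.
move=> h1 h2 hc hu hv; apply: function_field_ind => // [x y hx hy|x y hx hy|x x0 hx].
- by rewrite !raddfD /= hx hy.
- by rewrite h1 h2 hx hy.
- by rewrite !leibniz_inv // hx.
Qed.

Lemma scalar2M a b : scalar2 (a * b) = scalar2 a * scalar2 b.
Proof. by rewrite /scalar2 !polyCM tofracM. Qed.

Lemma scalar2_inj : injective scalar2.
Proof. by move=> a b /eqP; rewrite tofrac_eq => /eqP/polyC_inj/polyC_inj. Qed.

(** The Euler derivation in which u has weight one and v has weight mu. *)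
Lemma weight_derivation (mu : E) : exists d : {additive Q -> Q},
  [/\ leibniz d, forall c, d (scalar2 c) = 0, d var_u = var_u
    & d var_v = scalar2 mu * var_v].
Proof.
pose du (g : {poly E}) := g^`() * 'X.
have duadd : zmod_morphism du by move=> f g; rewrite /du derivB mulrBl.
pose du' : {additive {poly E} -> {poly E}} :=
  HB.pack du (GRing.isZmodMorphism.Build _ _ du duadd).
have duL : leibniz du'.
  by move=> f g; rewrite /= /du derivM mulrDl -!mulrA (mulrC g).
pose dp (f : {poly {poly E}}) := map_poly du' f * 1 + f^`() * (mu%:P%:P * 'X).
have dpadd : zmod_morphism dp.
  move=> f g; rewrite /dp !mulr1 raddfB derivB mulrBl opprD.
  by rewrite addrACA.
pose dp' : {additive {poly {poly E}} -> {poly {poly E}}} :=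
  HB.pack dp (GRing.isZmodMorphism.Build _ _ dp dpadd).
have dpL : leibniz dp'.
  apply: leibniz_combine; [exact: map_poly_leibniz|exact: derivM| |].
    by move=> f; rewrite mulrC.
  by move=> f; rewrite mulrC.
have [d dL dE] := fraction_derivation dpL.
have dpC (g : {poly E}) : dp g%:P = (du g)%:P.
  by rewrite /dp map_polyC derivC mul0r addr0 mulr1.
exists d; split => // [c||].
- by rewrite dE /= dpC /du derivC mul0r polyC0 tofrac0.
- by rewrite dE /= dpC /du derivX mul1r.
rewrite dE -tofracM; congr inQ; rewrite /= /dp derivX mul1r mulr1.
rewrite (_ : map_poly _ _ = 0) ?add0r //; apply/polyP => i.
rewrite coef_map coefX coef0; case: (_ == _); last exact: raddf0.
by rewrite /= /du derivC mul0r.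
Qed.

Section Perfect.
Context (p : nat) (hp : p \in [pchar Q]) (perfect : forall c : E, exists b, c = b ^+ p).

Let T : finType := ('I_p * 'I_p)%type.
Definition monomial2 (l : 'I_#|T|) : Q :=
  var_u ^+ (enum_val l).1 * var_v ^+ (enum_val l).2.

(** The subspace spanned over p-th powers by the u^i v^j, i, j < p, is a ring,
    since exponents may be reduced modulo p, and it contains inverses, as x^-1
    = (x^-1)^p x^(p-1). *)
Lemma frobenius_span z : exists c : 'I_#|T| -> Q,
  z = \sum_l pFrobenius_aut hp (c l) * monomial2 l.
Proof.
pose S z := exists c : 'I_#|T| -> Q, z = \sum_l pFrobenius_aut hp (c l) * monomial2 l.
have p0 : (0 < p)%N by apply/prime_gt0/(pcharf_prime hp).
have SD x y : S x -> S y -> S (x + y).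
  move=> [c ->] [c' ->]; exists (fun l => c l + c' l); rewrite -big_split.
  by apply: eq_bigr => l _; rewrite rmorphD mulrDl.
have S0 : S 0.
  by exists (fun=> 0); rewrite big1 // => l _; rewrite rmorph0 mul0r.
have SZ a x : S x -> S (a ^+ p * x).
  move=> [c ->]; exists (fun l => a * c l); rewrite mulr_sumr.
  by apply: eq_bigr => l _; rewrite rmorphM -mulrA.
have Suv i j : S (var_u ^+ i * var_v ^+ j).
  rewrite (divn_eq i p) (divn_eq j p) !exprD !exprM mulrACA -exprMn; apply: (SZ).
  pose t : T := (Ordinal (ltn_pmod i p0), Ordinal (ltn_pmod j p0)).
  exists (fun l => (l == enum_rank t)%:R).
  rewrite (bigD1 (enum_rank t)) //= eqxx rmorph1 mul1r /monomial2 enum_rankK /=.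
  by rewrite big1 ?addr0 // => l /negPf ->; rewrite rmorph0 mul0r.
have SM x y : S x -> S y -> S (x * y).
  move=> [c ->] [c' ->]; rewrite mulr_suml; apply: big_ind => // l _.
  rewrite mulr_sumr; apply: big_ind => // l' _.
  rewrite !pFrobenius_autE mulrACA -exprMn; apply: (SZ).
  by rewrite /monomial2 mulrACA -!exprD; exact: Suv.
apply: (@function_field_ind S) => // [c|||x x0 Sx].
- have [b ->] := perfect c.
  have -> : scalar2 (b ^+ p) = (scalar2 b) ^+ p * (var_u ^+ 0 * var_v ^+ 0).
    by rewrite !expr0 !mulr1 /scalar2 !polyC_exp tofracXn.
  by apply: (SZ).
- by have := Suv 1 0; rewrite expr0 mulr1.
- by have := Suv 0 1; rewrite expr0 mul1r.
have -> : x^-1 = (x^-1) ^+ p * x ^+ p.-1.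
  by rewrite -{1}(prednK p0) exprS -mulrA -exprMn mulVf // expr1n mulr1.
apply: (SZ); elim: (p.-1) => [|n IH]; first by have := Suv 0 0; rewrite !expr0 mulr1.
by rewrite exprS; exact: SM.
Qed.

End Perfect.
End FunctionField.

(** In the field with p^2 elements, t^p - t cannot vanish everywhere. *)
Lemma exists_frobenius_moved p : prime p -> exists (E : finFieldType) (l : E),
  [/\ p \in [pchar E], l ^+ p != l & forall c : E, (c ^+ p) ^+ p = c].
Proof.
move=> pr; have [E hp cE] := pPrimePowerField pr (isT : (0 < 2)%N).
suff [l hl] : exists l : E, l ^+ p != l.
  by exists E, l; split => // c; rewrite -exprM mulnn -cE expf_card.
apply: contrapT => /forallNP nl.
pose q : {poly E} := 'X^p - 'X.
have p1 := prime_gt1 pr.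
have sq : size q = p.+1.
  by rewrite /q size_polyDl ?size_polyXn // size_polyN size_polyX.
have q0 : q != 0 by rewrite -size_poly_eq0 sq.
have roots : all (root q) (enum E).
  apply/allP => x _; rewrite /root /q !hornerE subr_eq0.
  by apply/negPn/negP; exact: nl.
have := max_poly_roots q0 roots (enum_uniq E).
rewrite sq ltnS -cardE cE -mulnn -[X in (_ <= X)%N]muln1.
by rewrite leq_pmul2l ?(ltnW p1) // leqNgt p1.
Qed.

(** The base field is K itself, acting on K through the Frobenius map; this is
    the extension K / K^p. *)
Lemma noncancellative_example (R : realType) p : prime p ->
  exists (k : fieldType) (A : algType k),
    [/\ p \in [pchar k], affine A, is_domain A, GKdim A R = 1%E & ~ cancellative A].
Proof.
move=> pr; have [E [l [hE lp lpp]]] := exists_frobenius_moved pr.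
pose Q : fieldType := {fraction {poly {poly E}}}.
have hp : p \in [pchar Q].
  rewrite inE pr /= -(rmorph_nat (@FracField.tofrac {poly {poly E}})) tofrac_eq0.
  by rewrite -!polyC_natr !polyC_eq0 pcharf0.
have perfect c : exists b : E, c = b ^+ p by exists (c ^+ p); rewrite lpp.
have [d [dL dc du dv]] := weight_derivation l.
have [d' [dL' dc' du' dv']] := weight_derivation (l ^+ p).
pose iota : {rmorphism Q -> Q} := pFrobenius_aut hp.
have const (D : {additive Q -> Q}) : leibniz D -> forall c, D (iota c) = 0.
  by move=> DL c; rewrite /iota /= leibniz_exp // -mulr_natr pcharf0 ?mulr0.
have power (D1 D2 : {additive Q -> Q}) mu : leibniz D1 -> leibniz D2 ->
    (forall c, D1 (scalar2 c) = 0) -> (forall c, D2 (scalar2 c) = 0) ->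
    D1 (var_u E) = var_u E -> D2 (var_u E) = var_u E ->
    D1 (var_v E) = scalar2 mu * var_v E -> D2 (var_v E) = scalar2 (mu ^+ p) * var_v E ->
  forall z, iter p D1 z = D2 z.
  move=> L1 L2 c1 c2 u1 u2 v1 v2 z.
  have [D3 L3 E3] := iter_derivation hp L1; rewrite -E3.
  apply: (derivation_ext L3 L2) => [c||]; rewrite E3.
  - by rewrite c2; apply: (@iter_eq0_leq _ _ 1); [exact: prime_gt0|exact: c1].
  - by rewrite u2; elim: (p) => //= n ->.
  rewrite v2; elim: (p) => [|n IH]; first by rewrite expr0 /scalar2 tofrac1 mul1r.
  by rewrite iterS IH L1 c1 mul0r add0r v1 mulrA -scalar2M -exprSr.
have dp z : iter p d z = d' z by exact: (power d d' l).
have dp' z : iter p d' z = d z by apply: (power d' d (l ^+ p)) => //; rewrite lpp.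
pose K := DiffField dL (const d dL); pose K' := DiffField dL' (const d' dL').
exists Q, (ore K); split => //.
- exact: (@ore_affine Q K _ (@monomial2 E p) (frobenius_span hp perfect)).
- exact: ore_domain.
- exact: (@ore_GKdim R Q K _ (@monomial2 E p) (frobenius_span hp perfect)).
have insep (z : Q) : exists c, z ^+ p = iota c by exists z.
have nprop c : ~ (forall z, d z = c * d' z).
  move=> hc.
  have u0 : var_u E != 0 by rewrite tofrac_eq0 polyC_eq0 polyX_eq0.
  have v0 : var_v E != 0 by rewrite tofrac_eq0 polyX_eq0.
  have c1 : c = 1 by apply: (mulIf u0); rewrite -{1}du' -hc du mul1r.
  have := hc (var_v E); rewrite c1 mul1r dv dv' => /(mulIf v0)/scalar2_inj ll.
  by rewrite -ll eqxx in lp.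
move=> canc.
apply: (ore_not_iso hp insep nprop (dC := const d dL) (dC' := const d' dL')).
by apply: canc; exact: (poly_ore_iso hp dL dL' (const d dL) (const d' dL') dp dp').
Qed.

Theorem theorem1p1 (R : realType) :
  (forall (k : fieldType) (A : algType k),
     [pchar k] =i pred0 -> affine A -> is_domain A -> GKdim A R = 1%E ->
     cancellative A)
  /\
  (forall p : nat, prime p ->
     exists (k : fieldType) (A : algType k),
       [/\ p \in [pchar k], affine A, is_domain A, GKdim A R = 1%E
         & ~ cancellative A]).
Proof.
split=> [k A ch affA domA GK|p pr]; first exact: cancellation_GKdim1 GK.
exact: noncancellative_example.
Qed.
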